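(* Let $\alpha\in[0,1)$ and $\alpha^*:=1-k_h/\bar c\in[-\infty,1)$. For the infinite-horizon problem with discount factor $\alpha$ of the inventory model described in the context, the following statements hold: (i) if $\alpha^*<\alpha$, then an $(s_\alpha,S_\alpha)$ policy is optimal, where $S_\alpha\in\arg\min_{x\in\mathbb X}G_\alpha(x)$ and $s_\alpha:=\inf\{x\le S_\alpha: G_\alpha(x)\le K+G_\alpha(S_\alpha)\}$. Furthermore, a sequence of pairs $(s_{t,\alpha},S_{t,\alpha})_{t=N_\alpha,N_\alpha+1,\ldots}$, where $S_{t,\alpha}\in\arg\min_{x\in\mathbb X}G_{t,\alpha}(x)$ and $s_{t,\alpha}:=\inf\{x\le S_{t,\alpha}: G_{t,\alpha}(x)\le K+G_{t,\alpha}(S_{t,\alpha})\}$, is bounded, and, if $(s^*_\alpha,S^*_\alpha)$ is a limit point of this sequence, then the $(s^*_\alpha,S^*_\alpha)$ policy is optimal for the infinite-horizon problem with discount factor $\alpha$; (ii) if $\alpha^*\ge\alpha$, then the policy that never orders is optimal.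
   Context: Inventory model. $(\mathbb X,\mathbb A)$ is either $(\mathbb R,[0,+\infty))$ or $(\mathbb Z,\mathbb N_0)$ with $\mathbb N_0=\{0,1,2,\ldots\}$. Parameters: a fixed ordering cost $K>0$; a unit ordering cost $\bar c>0$; a convex function $h:\mathbb X\to[0,+\infty)$ with $h(0)=0$ and $h(x)\to\infty$ as $|x|\to\infty$ (on $\mathbb Z$, the convexity inequality is required whenever all points involved lie in $\mathbb Z$); i.i.d. nonnegative finite random variables $D_1,D_2,\ldots$ (integer-valued if $\mathbb X=\mathbb Z$), with $D$ denoting a random variable with the same distribution as $D_1$, $\mathbb E[D]<+\infty$, $\mathbb P(D>0)>0$, and $\mathbb E[h(x-D)]<+\infty$ for all $x\in\mathbb X$; a discount factor $\alpha\in[0,1)$. Put $\mathbf S_0:=0$, $\mathbf S_t:=\sum_{j=1}^tD_j$ for $t\ge1$. Dynamics: $x_{t+1}=x_t+a_t-D_{t+1}$, $t=0,1,\ldots$, where $x_t\in\mathbb X$ is the inventory level and $a_t\in\mathbb A$ the ordered amount. One-step cost: $c(x,a)=K I_{\{a>0\}}+\bar c a+\mathbb E[h(x+a-D)]$. Policies are (possibly randomized, history-dependent) sequences $\pi=(\pi_0,\pi_1,\ldots)$ of decision rules, $\pi_t$ being a regular transition probability from histories $(x_0,a_0,\ldots,a_{t-1},x_t)$ to $\mathbb A$. A stationary policy is a nonrandomized policy whose decisions depend only on the current state. For $N=0,1,\ldots$ let $v^\pi_{N,\alpha}(x)=\mathbb E^\pi_x\left[\sum_{t=0}^{N-1}\alpha^tc(x_t,a_t)\right]$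 and $v_{N,\alpha}(x)=\inf_\pi v^\pi_{N,\alpha}(x)$ (so $v_{0,\alpha}=0$); let $v^\pi_\alpha(x)=\mathbb E^\pi_x\left[\sum_{t=0}^{\infty}\alpha^tc(x_t,a_t)\right]$ and $v_\alpha(x)=\inf_\pi v_\alpha^\pi(x)$. A policy $\pi$ is optimal for the infinite-horizon problem if $v^\pi_\alpha(x)=v_\alpha(x)$ for all $x\in\mathbb X$. $G_{t,\alpha}(x):=\bar c x+\mathbb E[h(x-D)]+\alpha\mathbb E[v_{t,\alpha}(x-D)]$ for $t=0,1,\ldots$, and $G_\alpha(x):=\bar c x+\mathbb E[h(x-D)]+\alpha\mathbb E[v_\alpha(x-D)]$. $k_h:=-\lim_{x\to-\infty}h(x)/x\in(0,+\infty]$. $f_{t,\alpha}(x):=\bar c x+\sum_{i=0}^t\alpha^i\mathbb E[h(x-\mathbf S_{i+1})]$ (with $0^0=1$), $f_{t,\alpha}(-\infty):=\lim_{x\to-\infty}f_{t,\alpha}(x)$, and $N_\alpha:=\inf\{t\in\mathbb N_0: f_{t,\alpha}(-\infty)=+\infty\}$, with $\inf\emptyset=+\infty$ ($N_\alpha$ is finite when $\alpha>\alpha^*$). For real numbers $s\le S$, an $(s,S)$ policy is the stationary policy that at every step orders up to the level $S$ (i.e. $a=S-x$) when the current state satisfies $x<s$ and does not order ($a=0$) when $x\ge s$. *)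

(* Defs.v *)
From HB Require Import structures.
From mathcomp Require Import all_boot all_order all_algebra.
From mathcomp Require Import all_classical all_reals all_analysis.

Set Implicit Arguments.
Unset Strict Implicit.
Unset Printing Implicit Defensive.

Import Order.TTheory GRing.Theory Num.Theory.
Import numFieldNormedType.Exports.

Local Open Scope classical_set_scope.
Local Open Scope ring_scope.

(* Both cases live inside R: the discrete state space is the set of integers
   of R, and functions or policies on it are functions or kernels on R that
   are only constrained on, and only matter on, that set. *)
Inductive space_kind := Continuous | Discrete.

Section Space.
Variable R : realType.

Definition states (k : space_kind) : set R :=
  match k with
  | Continuous => setT
  | Discrete => range (fun z : int => z%:~R)
  end.

Definition actions (k : space_kind) : set R := states k `&` `[0, +oo[.

Definition states_pinfty (k : space_kind) := within (states k) (pinfty_nbhs R).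
Definition states_ninfty (k : space_kind) := within (states k) (ninfty_nbhs R).

Definition convex_on (X : set R) (f : R -> R) : Prop :=
  forall x y l : R, X x -> X y -> 0 <= l <= 1 -> X (l * x + (1 - l) * y) ->
    f (l * x + (1 - l) * y) <= l * f x + (1 - l) * f y.

(* (x_0, a_0), ..., (x_{t-1}, a_{t-1}) together with x_t *)
Definition history (t : nat) : Type := (t.-tuple (R * R) * R)%type.

Definition histories (k : space_kind) (t : nat) : set (history t) :=
  [set h | (forall i : 'I_t, states k (tnth h.1 i).1 /\
                             actions k (tnth h.1 i).2) /\ states k h.2].

Record policy (k : space_kind) := Policy {
  rule :> forall t : nat, R.-pker (t.-tuple (R * R) * R) ~> R ;
  rule_actions : forall t h, histories k h -> rule t h (actions k) = 1%E }.

(* Trajectories (x_t, a_t)_t with the product sigma-algebra. *)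
Definition cylinders : set (set (nat -> R * R)) :=
  \bigcup_t preimage_set_system setT (fun w : nat -> R * R => w t) measurable.

Definition trajectory := g_sigma_algebraType cylinders.

Definition state_at (t : nat) (w : trajectory) : R := (w t).1.
Definition action_at (t : nat) (w : trajectory) : R := (w t).2.

Definition history_at (t : nat) (w : trajectory) : history t :=
  ([tuple w i | i < t], state_at t w).

Definition stationary_with (k : space_kind) (phi : R -> R) (pi : policy k) :=
  forall t (h : history t), histories k h ->
    forall B : set R, measurable B -> pi t h B = \d_(phi h.2) B.

Definition sS_rule (s S x : R) : R := if x < s then S - x else 0.

Definition argmin_on (X : set R) (G : R -> \bar R) (S : R) : Prop :=
  X S /\ forall y, X y -> (G S <= G y)%E.

End Space.

Definition mutually_independent d (T : measurableType d) (R : realType)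
    (P : probability T R) (Y : nat -> T -> R) : Prop :=
  forall (J : seq nat) (B : nat -> set R), uniq J ->
    (forall j, measurable (B j)) ->
    P [set w | forall j, j \in J -> B j (Y j w)] =
    (\prod_(j <- J) P (Y j @^-1` B j))%E.

Definition identically_distributed d (T : measurableType d) (R : realType)
    (P : probability T R) (Y : nat -> T -> R) : Prop :=
  forall j (B : set R), measurable B -> P (Y j @^-1` B) = P (Y 0%N @^-1` B).

(* demand M j is D_{j+1} *)
Record inventory d (T : measurableType d) (R : realType)
    (P : probability T R) := Inventory {
  kind : space_kind ;
  setup_cost : R ;
  unit_cost : R ;
  holding : R -> R ;
  demand : nat -> {RV P >-> R} ;
  setup_cost_gt0 : 0 < setup_cost ;
  unit_cost_gt0 : 0 < unit_cost ;
  holding_ge0 : forall x, states kind x -> 0 <= holding x ;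
  holding_convex : convex_on (states kind) holding ;
  holding0 : holding 0 = 0 ;
  holding_pinfty : holding x @[x --> @states_pinfty R kind] --> +oo ;
  holding_ninfty : holding x @[x --> @states_ninfty R kind] --> +oo ;
  demand_states : forall j w, states kind (demand j w) ;
  demand_ge0 : forall j w, 0 <= demand j w ;
  demand_indep : mutually_independent P demand ;
  demand_ident : identically_distributed P demand ;
  demand_mean : ('E_P[demand 0%N] < +oo)%E ;
  demand_nontrivial : (0 < P [set w | (0 < demand 0%N w)%R])%E ;
  holding_mean : forall x, states kind x ->
    ('E_P[fun w => holding (x - demand 0%N w)%R] < +oo)%E }.

Section Model.
Variables (d : measure_display) (T : measurableType d) (R : realType).
Variables (P : probability T R) (M : inventory P).

Local Notation X := (states (kind M)).
Local Notation h := (holding M).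
Local Notation cbar := (unit_cost M).
Local Notation D := (demand M 0%N).
Local Notation Policy := (@policy R (kind M)).

Definition cost (x a : R) : \bar R :=
  (((if 0 < a then setup_cost M else 0) + cbar * a)%:E +
   'E_P[fun w => h (x + a - D w)%R])%E.

(* Law of x_{t+1} given x_t = x and a_t = a. *)
Definition transition (x a : R) (E : set R) : \bar R :=
  P ((fun w => x + a - D w) @^-1` E).

(* Q is the law of the trajectory under pi started at x. *)
Definition strategic_measure (pi : Policy) (x : R)
    (Q : probability (trajectory R) R) : Prop :=
  [/\ Q [set w | state_at 0 w = x] = 1%E,
      forall t (B : set (t.-tuple (R * R) * R)) (C : set R),
        measurable B -> measurable C ->
        Q [set w | B (history_at t w) /\ C (action_at t w)] =
        (\int[Q]_(w in [set w | B (history_at t w)]) pi t (history_at t w) C)%E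
    & forall t (B : set (t.-tuple (R * R) * R)) (C E : set R),
        measurable B -> measurable C -> measurable E ->
        Q [set w | [/\ B (history_at t w), C (action_at t w)
                     & E (state_at t.+1 w)]] =
        (\int[Q]_(w in [set w | B (history_at t w) /\ C (action_at t w)])
           transition (state_at t w) (action_at t w) E)%E].

(* E^pi_x[F]. By the Ionescu-Tulcea theorem, for x in X there is exactly one
   strategic measure, so that the infimum is over a singleton: it only serves
   to name the integral without building that measure. *)
Definition expect (pi : Policy) (x : R) (F : trajectory R -> \bar R) : \bar R :=
  ereal_inf [set (\int[Q]_w F w)%E | Q in strategic_measure pi x].

Variable alpha : R.

Definition stage_cost (t : nat) (w : trajectory R) : \bar R :=
  ((alpha ^+ t)%:E * cost (state_at t w) (action_at t w))%E.

Definition policy_value_fin (N : nat) (pi : Policy) (x : R) : \bar R :=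
  expect pi x (fun w => \sum_(t < N) stage_cost t w)%E.

Definition value_fin (N : nat) (x : R) : \bar R :=
  ereal_inf [set policy_value_fin N pi x | pi in setT].

Definition policy_value (pi : Policy) (x : R) : \bar R :=
  expect pi x (fun w => \sum_(0 <= t <oo) stage_cost t w)%E.

Definition value (x : R) : \bar R :=
  ereal_inf [set policy_value pi x | pi in setT].

Definition optimal (pi : Policy) : Prop :=
  forall x, X x -> policy_value pi x = value x.

Definition G_of (v : R -> \bar R) (x : R) : \bar R :=
  ((cbar * x)%:E + 'E_P[fun w => h (x - D w)%R] +
   alpha%:E * \int[P]_w v (x - D w)%R)%E.

Definition G_fin (t : nat) : R -> \bar R := G_of (value_fin t).
Definition G_inf : R -> \bar R := G_of value.

Definition k_h : \bar R :=
  (- lim ((h x / x)%:E @[x --> @states_ninfty R (kind M)]))%E.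

Definition alpha_star : \bar R := (1 - k_h * (cbar^-1)%:E)%E.

Definition total_demand (n : nat) (w : T) : R := \sum_(j < n) demand M j w.

Definition f_ (t : nat) (x : R) : \bar R :=
  ((cbar * x)%:E + \sum_(i < t.+1) (alpha ^+ i)%:E *
     'E_P[fun w => h (x - total_demand i.+1 w)%R])%E.

Definition f_ninfty (t : nat) : \bar R :=
  lim (f_ t x @[x --> @states_ninfty R (kind M)]).

Definition N_ : \bar R :=
  ereal_inf [set (t%:R : R)%:E | t in [set t : nat | f_ninfty t = +oo%E]].

(* Infimum in the extended reals, so that a set unbounded below gives -oo. *)
Definition reorder_level (G : R -> \bar R) (S : R) : \bar R :=
  ereal_inf [set x%:E | x in
    [set x : R | [/\ X x, (x <= S)%R & (G x <= (setup_cost M)%:E + G S)%E]]].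

Definition stationary_optimal (phi : R -> R) : Prop :=
  exists2 pi : Policy, stationary_with phi pi & optimal pi.

(* A policy takes values in A, so this entails that the order quantities
   S - x, for x < s, are admissible. *)
Definition sS_optimal (s S : R) : Prop :=
  s <= S /\ stationary_optimal (sS_rule s S).

Definition never_order_optimal : Prop := stationary_optimal (fun=> 0).

End Model.

(* Main.v *)
Require Import Defs.
From HB Require Import structures.
From mathcomp Require Import all_boot all_order all_algebra.
From mathcomp Require Import all_classical all_reals all_analysis.
From mathcomp Require Import measurable_realfun.
From mathcomp Require Import ring lra.

Set Implicit Arguments.
Unset Strict Implicit.
Unset Printing Implicit Defensive.

Import Order.TTheory GRing.Theory Num.Theory.
Import numFieldNormedType.Exports.
Local Open Scope classical_set_scope.
Local Open Scope ring_scope.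

(** Write X for the state space, H x for the expected holding cost of a period
  that starts at level x after ordering, and, for a function v on X,
  G v x = c x + H x + alpha E v (x - D).  Ordering from x up to y >= x costs
  K 1(y > x) + G v y - c x when the continuation is worth v, so one step of
  dynamic programming maps v to
    bellman v x = min (G v x, K + inf (G v y | y in X, y >= x)) - c x.
  Let v_t be the iterates of bellman from 0 and v their supremum.

  Identification of the values.  Under any policy the costs of the first n
  periods plus the discounted v_(N - n) of the current state have
  nondecreasing expectation in n, because bellman is a minimum over the
  available orders; hence v_N bounds the N-period value from below, and v
  bounds the infinite-horizon value (cost_fin_ge, cost_inf_ge).  Only the
  one-dimensional marginals of the trajectory enter, through
  integral_next_state.  Conversely a measurable rule that attains the minimum
  in the equation bellman v = v has total cost at most v (conserving_value):
  the discounted remainder is nonnegative and can be dropped.  The law of the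
  trajectory under such a rule is the image of the law of the demands, and it
  has the conditional distributions of the controlled process because the
  history up to t is independent of D_(t+1) (strategic_path_law).

  Regularity.  All the functions involved are lower semicontinuous on X and
  lie below the cost of a simple policy (dominated).  Lower semicontinuity is
  preserved by the expectation, by Fatou's lemma, by running infima, and by
  increasing limits, and it suffices for everything: minima are attained, the
  smallest minimizer to the right of x is monotone in x, hence measurable, and
  limits of minimizers of G v_t minimize G v (Gf_cluster).  The last point
  also gives the optimality equation for v (vlim_fixed).  On the integers
  semicontinuity holds trivially, so both models are treated at once.

  Shape of the policies.  Scarf's K-convexity passes from v to G v and from
  G v to bellman v (kconvex_bellman).  If S minimizes G v and G v is above
  K + G v S to the left of s and at most that value at s, K-convexity shows
  that for x >= s no y >= x is worth the setup cost (wait_above), so the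
  (s, S) rule attains the minimum (sS_conserving).  The inequalities required
  of a limit point of (s_t, S_t) pass to the limit, again because G v_t
  increases to G v and is lower semicontinuous (sS_cluster).

  Role of the discount factor.  Only the behaviour of G v_t at minus infinity
  is left.  There h grows like k_h |x|, and by induction v_t grows with slope
  min (c, k_h (1 + alpha + ... + alpha^(t-1))), the cap c being the price of
  ordering back to a bounded region.  So G v_t tends to infinity as soon as
  k_h (1 + ... + alpha^t) > c (coercive_Gviter).  This same inequality
  characterizes f_t(-oo) = +oo (f_ninfty_slope, f_ninfty_eq), and it holds for
  large t exactly when k_h > c (1 - alpha), that is alpha > alpha_star.
  If alpha <= alpha_star, then h has slope at least - c (1 - alpha); by induction
  the functions v_t have slope at least - c and every G v_t is nondecreasing,
  so an order never pays (never_order_conserving). *)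

(** * The state space *)

Section States.
Variables (R : realType) (k : space_kind).
Local Notation X := (states (R:=R) k).

Lemma states0 : X 0.
Proof. by case: k => //=; exists 0. Qed.

Lemma states1 : X 1.
Proof. by case: k => //=; exists 1. Qed.

Lemma statesB x y : X x -> X y -> X (x - y).
Proof.
case: k => //= -[m _ <-] [n _ <-]; exists (m - n) => //.
by rewrite intrD mulrNz.
Qed.

Lemma statesN x : X x -> X (- x).
Proof. by move=> Xx; rewrite -sub0r; exact: statesB states0 Xx. Qed.

Lemma statesD x y : X x -> X y -> X (x + y).
Proof. by move=> Xx Xy; rewrite -[y]opprK; apply: statesB => //; exact: statesN. Qed.

Lemma states_above x : exists2 y, X y & x <= y.
Proof.
exists (Num.trunc x).+1%:R; last exact/ltW/truncnS_gt.
by case: k => //=; exists (Num.trunc x).+1%:Z.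
Qed.

(** Distinct integers are at distance at least 1, so two integers close to the
  same adherent point coincide, and that common integer is the point. *)
Lemma closed_states : closed X.
Proof.
case: k => /=; first exact: closedT.
move=> x clx; apply: contrapT => nx.
have gt0 z : 0 < `|x - z%:~R|.
  by rewrite normr_gt0 subr_eq0; apply/eqP => xz; apply: nx; exists z.
have near (e : R) : 0 < e -> exists z : int, `|x - z%:~R| < e.
  move=> e0; have [_ [[z _ <-]]] := clx _ (nbhsx_ballx x _ e0).
  by exists z.
have [z hz] := near 2^-1 ltac:(by []).
have [z' hz'] := near _ (gt0 z).
have : `|(z - z')%:~R : R| < 1%:~R.
  rewrite intrD mulrNz.
  have -> : z%:~R - z'%:~R = (x - z'%:~R) - (x - z%:~R) :> R by ring.
  apply: le_lt_trans (ler_normB _ _) _.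
  have := lt_trans hz' hz; lra.
rewrite -intr_norm ltr_int => h.
have zz' : z = z'.
  by apply/eqP; rewrite -subr_eq0 -normr_le0 -ltzD1 add0r.
by move: hz'; rewrite zz' ltxx.
Qed.

Lemma measurable_states : measurable X.
Proof. exact: closed_measurable closed_states. Qed.

Lemma measurable_actions : measurable (actions (R:=R) k).
Proof. by apply: measurableI; [exact: measurable_states|exact: measurable_itv]. Qed.

Lemma actionsE a : actions k a <-> X a /\ 0 <= a.
Proof. by rewrite /actions/=; split=> -[? h]; split=> //; move: h; rewrite in_itv/= andbT. Qed.

End States.

(** * Independence of the past and the next demand *)

Section Independence.
Context d (T : measurableType d) (R : realType) (P : probability T R).
Variable Y : nat -> {RV P >-> R}.
Hypothesis indepY : mutually_independent P Y.

(** The events on which mutual independence is stated: constraints on finitely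
  many coordinates. *)
Definition joint (J : seq nat) (E : nat -> set R) : set T :=
  [set w | forall j, j \in J -> E j (Y j w)].

(** Independence of Z from all the Y j with j >= t, in the form that can be
  propagated in time: it is stated against every finite block of later
  coordinates at once. *)
Definition indep_future d' (H : measurableType d') (t : nat) (Z : T -> H) :=
  forall (B : set H) (J : seq nat) (E : nat -> set R), measurable B ->
    uniq J -> (forall j, j \in J -> (t <= j)%N) ->
    (forall j, measurable (E j)) ->
    P (Z @^-1` B `&` joint J E) = (P (Z @^-1` B) * P (joint J E))%E.

Lemma joint_cons j J E :
  joint (j :: J) E = Y j @^-1` E j `&` joint J E.
Proof.
apply/seteqP; split=> [w h|w [h0 h] i]; last first.
  by rewrite inE => /predU1P[->//|/h].
by split=> [|i iJ]; apply: h; rewrite inE ?eqxx// iJ orbT.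
Qed.

Lemma measurable_joint J E : (forall j, measurable (E j)) ->
  measurable (joint J E).
Proof.
move=> mE; elim: J => [|j J IH].
  by rewrite (_ : joint _ _ = setT)//; apply/seteqP; split.
by rewrite joint_cons; apply: measurableI => //; rewrite -[X in measurable X]setTI;
  exact: measurable_funP.
Qed.

Lemma indep_future_cst d' (H : measurableType d') (z : H) t :
  indep_future t (fun=> z).
Proof.
move=> B J E mB uJ tJ mE; have mJ := measurable_joint J mE.
have [Bz|Bz] := pselect (B z).
  rewrite (_ : (fun=> z) @^-1` B = setT); last by apply/seteqP; split.
  by rewrite setTI probability_setT mul1e.
rewrite (_ : (fun=> z) @^-1` B = set0); last by apply/seteqP; split.
by rewrite set0I measure0 mul0e.
Qed.

(** Absorbing Y t into the past. On a product set the claim is the product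
  rule for the block enlarged by t; two finite measures on the product space
  that agree on product sets are equal, so it holds for every measurable
  event about the pair (Z, Y t). *)
Lemma indep_future_step d' (H : measurableType d') d'' (H' : measurableType d'')
    t (Z : T -> H) (F : H * R -> H') :
  measurable_fun setT Z -> measurable_fun setT F ->
  indep_future t Z -> indep_future t.+1 (fun w => F (Z w, Y t w)).
Proof.
move=> mZ mF iZ B J E mB uJ tJ mE.
have mJ := measurable_joint J mE.
have mZY : measurable_fun setT (fun w => (Z w, Y t w)).
  by apply: measurable_fun_pair => //; exact: measurable_funP.
have tNJ : t \notin J by apply/negP => /tJ; rewrite ltnn.
suff key : forall C : set (H * R), measurable C ->
    P ((fun w => (Z w, Y t w)) @^-1` C `&` joint J E) =
    (P ((fun w => (Z w, Y t w)) @^-1` C) * P (joint J E))%E.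
  by apply: (key (F @^-1` B)); rewrite -[X in measurable X]setTI; exact: mF.
pose ZY : {mfun T >-> (H * R)%type} :=
  HB.pack (fun w => (Z w, Y t w)) (isMeasurableFun.Build _ _ _ _ _ mZY).
pose p := fine (P (joint J E)).
have pE : P (joint J E) = p%:E by rewrite fineK// fin_num_measure.
have p0 : 0 <= p by rewrite fine_ge0.
pose m1_ : {measure set (H * R) -> \bar R} := pushforward (mrestr P mJ) ZY.
pose m1 := m1_ (measurable_funP ZY).
pose m2 : {measure set (H * R) -> \bar R} :=
  mscale (NngNum p0) (distribution P ZY).
move=> C mC.
suff : m1 C = m2 C.
  rewrite /m1 /m1_ /m2/= /mscale/= /distribution/= /pushforward /mrestr/= => ->.
  by rewrite pE muleC.
pose G : set (set (H * R)) :=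
  [set A `*` D | A in measurable & D in measurable].
apply: (measure_unique G (fun=> setT)) => //.
- by rewrite measurable_prod_measurableType.
- move=> _ _ [A mA [D mD <-]] [A' mA' [D' mD' <-]]; rewrite -setXI.
  by exists (A `&` A'); [exact: measurableI|exists (D `&` D') => //; exact: measurableI].
- by move=> _; exists setT => //; exists setT => //; rewrite setXTT.
- by apply/seteqP; split => // x _; exists 0%N.
- move=> _ [A mA [D mD <-]].
  rewrite /m1 /m1_ /m2/= /mscale/= /distribution/= /pushforward /mrestr/=.
  have -> : (fun w => (Z w, Y t w)) @^-1` (A `*` D) = Z @^-1` A `&` Y t @^-1` D.
    by apply/seteqP; split.
  pose E' := fun j => if j == t then D else E j.
  have mE' j : measurable (E' j) by rewrite /E'; case: ifP.
  have EE' : joint J E = joint J E'.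
    apply/seteqP; split=> w h j jJ; have := h j jJ; rewrite /E';
      case: eqP => // jt; by rewrite jt (negbTE tNJ) in jJ.
  have YD : Y t @^-1` D = joint [:: t] E'.
    rewrite joint_cons /E' eqxx (_ : joint [::] _ = setT) ?setIT//.
    by apply/seteqP; split.
  have YDJ : Y t @^-1` D `&` joint J E = joint (t :: J) E'.
    by rewrite joint_cons -EE' {1}/E' eqxx.
  rewrite -setIA YDJ YD !iZ//.
  + rewrite muleCA; congr (_ * _)%E; rewrite -[X in (X * _)%E]/(p%:E) -pE EE'.
    by rewrite !(indepY (J:=_))//= ?tNJ// big_cons big_seq1 muleC.
  + by move=> j; rewrite inE => /eqP ->.
  + by rewrite /= tNJ.
  + by move=> j; rewrite inE => /predU1P[->//|/tJ /ltnW].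
- move=> _; rewrite /m1 /m1_/= /pushforward /mrestr/= preimage_setT setTI.
  by rewrite (le_lt_trans (probability_le1 _ mJ))// ltry.
Qed.

(** By independence the joint law of (Z, Y t) is a product measure, and its
  second factor is the law of Y 0 since the Y j are identically distributed;
  the right-hand side is the definition of the product measure by sections. *)
Lemma indep_future_law d' (H : measurableType d') (Z : T -> H) t
    (C : set (H * R)) :
  identically_distributed P Y ->
  measurable_fun setT Z -> indep_future t Z -> measurable C ->
  P ((fun w => (Z w, Y t w)) @^-1` C) =
  (\int[P]_w P [set w' | C (Z w, Y 0%N w')])%E.
Proof.
move=> idY mZ iZ mC.
have mZY : measurable_fun setT (fun w => (Z w, Y t w)).
  by apply: measurable_fun_pair => //; exact: measurable_funP.
pose ZY : {mfun T >-> (H * R)%type} :=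
  HB.pack (fun w => (Z w, Y t w)) (isMeasurableFun.Build _ _ _ _ _ mZY).
pose Zm : {mfun T >-> H} := HB.pack Z (isMeasurableFun.Build _ _ _ _ _ mZ).
have := @product_measure_unique _ _ _ _ _ (distribution P Zm)
  (distribution P (Y 0%N)) (distribution P ZY).
move=> /(_ _ C mC) h; rewrite -[LHS]/(distribution P ZY C) -h; last first.
  move=> A D mA mD;
  rewrite -[LHS]/(P ((fun w => (Z w, Y t w)) @^-1` (A `*` D))).
  rewrite -[RHS]/(P (Z @^-1` A) * P (Y 0%N @^-1` D))%E.
  rewrite [X in P X](_ : _ = Z @^-1` A `&` Y t @^-1` D); last first.
    by apply/seteqP; split.
  have YD : Y t @^-1` D = joint [:: t] (fun=> D).
    rewrite joint_cons (_ : joint [::] _ = setT) ?setIT//.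
    by apply/seteqP; split.
  rewrite YD iZ -?YD ?idY// => j; rewrite inE => /eqP -> //.
rewrite /product_measure1 ge0_integral_distribution//.
- apply: eq_integral => w _ /=; rewrite /distribution /pushforward/=; congr (P _).
  by rewrite /xsection; apply/seteqP; split=> w'; rewrite /preimage/= inE.
- exact: measurable_fun_xsection.
Qed.

End Independence.

(** * The law of the trajectory under a deterministic Markov rule *)

Section Trajectories.
Context (R : realType).

Lemma measurable_coord t : measurable_fun setT (fun w : trajectory R => w t).
Proof.
move=> _ B mB; rewrite setTI; apply: sub_sigma_algebra => /=.
by exists t => //; exists B => //; rewrite setTI.
Qed.

Lemma measurable_trajectory d (T : measurableType d) (f : T -> trajectory R) :
  (forall t, measurable_fun setT (fun w => f w t)) -> measurable_fun setT f.
Proof.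
move=> mf; apply: (@measurability _ _ T (trajectory R) setT f (@cylinders R) erefl).
move=> _ [_ [t _ [B mB <-]] <-]; rewrite setTI.
by have := mf t measurableT B mB; rewrite !setTI.
Qed.

Lemma measurable_state_at t : measurable_fun setT (@state_at R t).
Proof. exact: measurableT_comp (measurable_coord t). Qed.

Lemma measurable_action_at t : measurable_fun setT (@action_at R t).
Proof. exact: measurableT_comp (measurable_coord t). Qed.

Lemma measurable_history_at t : measurable_fun setT (@history_at R t).
Proof.
apply: measurable_fun_pair; last exact: measurable_state_at.
apply/measurable_fun_tnthP => i /=.
rewrite (_ : _ \o _ = fun w : trajectory R => w i); first exact: measurable_coord.
by apply/funext => w /=; rewrite tnth_mktuple.
Qed.

End Trajectories.

Section StrategicMeasure.
Context d (T : measurableType d) (R : realType) (P : probability T R).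
Variable M : inventory P.
Local Notation X := (@states R (kind M)).
Local Notation A := (actions (R:=R) (kind M)).
Local Notation D := (demand M).

(** The section map of a measurable set of the product with the demand space. *)
Lemma measurable_transition (E : set R) : measurable E ->
  measurable_fun setT (fun xa : R * R => transition M xa.1 xa.2 E).
Proof.
move=> mE; pose f := fun z : (R * R) * T => z.1.1 + z.1.2 - D 0%N z.2.
have mf : measurable_fun setT f.
  apply: measurable_funB.
    apply: measurable_funD; apply: measurableT_comp => //.
  exact: measurableT_comp.
have mfE : measurable (f @^-1` E) by rewrite -[X in measurable X]setTI; exact: mf.
rewrite (_ : (fun _ => _) = P \o xsection (f @^-1` E)).
  exact: measurable_fun_xsection.
apply/funext => xa /=; congr (P _); apply/seteqP.
by split => w; rewrite /xsection/preimage/= inE.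
Qed.

Section Markov.
Variable phi : nat -> R -> R.
Hypothesis mphi : forall t, measurable_fun setT (phi t).
Variable x : R.

Fixpoint state_path (t : nat) (w : T) : R :=
  if t is t'.+1 then
    let y := state_path t' w in y + phi t' y - D t' w
  else x.

Definition traj (w : T) : trajectory R :=
  fun t => (state_path t w, phi t (state_path t w)).

(** The history at time t, encoded as a trajectory that is frozen at its state
  at t. Keeping one and the same type for all t lets the history be built up
  by induction. *)
Definition stopped_path (t : nat) (w : T) : trajectory R :=
  fun i => if (i < t)%N then traj w i else (state_path t w, 0).

Lemma measurable_state_path t : measurable_fun setT (state_path t).
Proof.
elim: t => [|t IH]; first exact: measurable_cst.
apply: measurable_funB; last exact: measurable_funP.
by apply: measurable_funD => //; exact: measurableT_comp.
Qed.

Lemma measurable_traj : measurable_fun setT traj.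
Proof.
apply: measurable_trajectory => t; apply: measurable_fun_pair.
  exact: measurable_state_path.
by apply: measurableT_comp => //; exact: measurable_state_path.
Qed.

Lemma measurable_stopped_path t : measurable_fun setT (stopped_path t).
Proof.
apply: measurable_trajectory => i; rewrite /stopped_path.
case: (i < t)%N.
  by apply: measurable_fun_pair; [|apply: measurableT_comp => //];
    exact: measurable_state_path.
by apply: measurable_fun_pair => //; exact: measurable_state_path.
Qed.

Lemma history_stopped t w : history_at t (traj w) = history_at t (stopped_path t w).
Proof.
rewrite /history_at /state_at /stopped_path ltnn/=; congr pair.
by apply: eq_from_tnth => i; rewrite !tnth_mktuple ltn_ord.
Qed.

Let step (t : nat) (z : trajectory R * R) : trajectory R := fun i =>
  if (i < t)%N then z.1 i
  else let y := (z.1 t).1 in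
       if i == t then (y, phi t y) else (y + phi t y - z.2, 0).

Lemma measurable_step t : measurable_fun setT (step t).
Proof.
have m1 i : measurable_fun setT (fun z : trajectory R * R => z.1 i).
  exact: (measurableT_comp (@measurable_coord R i)).
have m2 i : measurable_fun setT (fun z : trajectory R * R => (z.1 i).1).
  exact: (measurableT_comp measurable_fst (m1 i)).
have m3 i : measurable_fun setT (fun z : trajectory R * R => phi t (z.1 i).1).
  exact: measurableT_comp.
apply: measurable_trajectory => i; rewrite /step.
case: (i < t)%N => //; case: (i == t); first exact: measurable_fun_pair.
apply: measurable_fun_pair => //; apply: measurable_funB => //.
exact: measurable_funD.
Qed.

Lemma indep_stopped_path t : indep_future D t (stopped_path t).
Proof.
elim: t => [|t IH].
  rewrite (_ : stopped_path 0 = fun=> (fun=> (x, 0)))//.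
  exact: indep_future_cst.
have -> : stopped_path t.+1 = fun w => step t (stopped_path t w, D t w).
  apply/funext => w; apply/funext => i; rewrite /stopped_path /step/= ltnS ltnn.
  by case: ltngtP => //= ->.
apply: indep_future_step => //.
- exact: demand_indep.
- exact: measurable_stopped_path.
- exact: measurable_step.
Qed.

Definition path_rv : {mfun T >-> trajectory R} :=
  HB.pack traj (isMeasurableFun.Build _ _ _ _ _ measurable_traj).

Definition path_law : probability (trajectory R) R := distribution P path_rv.

Lemma path_law_action t w : action_at t (traj w) = phi t (state_at t (traj w)).
Proof. by []. Qed.

Hypothesis Xx : X x.
Hypothesis phiA : forall t y, X y -> A (phi t y).

Lemma states_state_path t w : X (state_path t w).
Proof.
elim: t => //= t IH; apply: statesB; last exact: demand_states.
by apply: statesD => //; have /actionsE[] := phiA t IH.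
Qed.

Lemma histories_path t w : histories (kind M) (history_at t (traj w)).
Proof.
split=> [i|]; last exact: states_state_path.
rewrite tnth_mktuple; split; first exact: states_state_path.
by apply: phiA; exact: states_state_path.
Qed.

(** The first two clauses hold by construction, the actions being functions of
  the state. The third one compares the joint law of the history and of the
  actual demand D_(t+1) with the integral against an independent copy of
  D_1, which is indep_future_law. *)
Lemma strategic_path_law (pi : policy R (kind M)) :
  (forall t (h : history R t) B, measurable B -> histories (kind M) h ->
     pi t h B = \d_(phi t h.2) B) ->
  strategic_measure pi x path_law.
Proof.
move=> piE.
have mphist t : measurable_fun setT (fun w => history_at t (traj w)).
  apply: (measurableT_comp (@measurable_history_at R t)).
  exact: measurable_traj.
have mpact t : measurable_fun setT (fun w => phi t (state_path t w)).
  by apply: measurableT_comp => //; exact: measurable_state_path.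
have mH t B : measurable B -> measurable [set w : trajectory R | B (history_at t w)].
  by move=> mB; rewrite -[X in measurable X]setTI; exact: measurable_history_at.
have mA t C : measurable C -> measurable [set w : trajectory R | C (action_at t w)].
  by move=> mC; rewrite -[X in measurable X]setTI; exact: measurable_action_at.
split.
- rewrite -[LHS]/(P [set w | x = x]) (_ : [set _ | _] = setT) ?probability_setT//.
  by apply/seteqP; split.
- move=> t B C mB mC.
  rewrite ge0_integral_pushforward//; last 2 first.
  + exact: mH.
  + apply: measurable_funTS.
    apply: (measurableT_comp (measurable_kernel (pi t) C mC)).
    exact: measurable_history_at.
  pose S := [set w | C (action_at t (traj w))].
  transitivity (\int[P]_(w in traj @^-1` [set w | B (history_at t w)])
      (\1_S w)%:E)%E.
    rewrite integral_indic.
    + by rewrite setIC.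
    + by rewrite -[X in measurable X]setTI; apply: measurable_traj => //; exact: mH.
    + by rewrite -[X in measurable X]setTI; apply: (mpact t).
  apply: eq_integral => w _ /=; rewrite piE//; last exact: histories_path.
- move=> t B C E mB mC mE.
  have mBC : measurable [set w : trajectory R |
      B (history_at t w) /\ C (action_at t w)].
    by apply: measurableI; [exact: mH|exact: mA].
  have mtrans : measurable_fun setT (fun w : trajectory R =>
      transition M (state_at t w) (action_at t w) E).
    apply: (measurableT_comp (measurable_transition mE)).
    exact: measurable_coord.
  rewrite ge0_integral_pushforward//; last exact: measurable_funTS.
  pose y (z : trajectory R * R) := (z.1 t).1.
  have my : measurable_fun setT y.
    apply: (measurableT_comp (@measurable_state_at R t)) => //.
  have myphi : measurable_fun setT (phi t \o y) by exact: measurableT_comp.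
  pose C' : set (trajectory R * R) := [set z |
    [/\ B (history_at t z.1), C (phi t (y z)) & E (y z + phi t (y z) - z.2)]].
  have mC' : measurable C'.
    rewrite (_ : C' = (fun z => history_at t z.1) @^-1` B `&`
      ((phi t \o y) @^-1` C `&` (fun z => y z + phi t (y z) - z.2) @^-1` E)).
      apply: measurableI; [|apply: measurableI]; rewrite -[X in measurable X]setTI.
      + by apply: (measurableT_comp (@measurable_history_at R t)).
      + exact: myphi.
      + by apply: measurable_funB => //; exact: measurable_funD.
    by apply/seteqP; split => z; [case|case=> ? []].
  transitivity (P ((fun w => (stopped_path t w, D t w)) @^-1` C')).
    rewrite -[LHS]/(P (traj @^-1` _)); congr (P _); apply/seteqP.
    have yE w : y (stopped_path t w, D t w) = state_path t w.
      by rewrite /y/= /stopped_path ltnn.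
    by split => w /=; rewrite /C'/= history_stopped yE.
  rewrite (indep_future_law (demand_ident M))//.
  + rewrite [RHS]integral_mkcond; apply: eq_integral => w _.
    rewrite patchE /=; case: ifPn => [/set_mem|/negP BC].
      rewrite /preimage/= history_stopped => -[Bw Cw].
      rewrite /transition; congr (P _); apply/seteqP.
      have yE : y (stopped_path t w, 0) = state_path t w.
        by rewrite /y/= /stopped_path ltnn.
      rewrite /y/= in yE; rewrite /C' /y/=.
      by split => w' /=; rewrite yE; [case|move=> ?; split].
    rewrite [X in P X](_ : _ = set0) ?measure0//.
    apply/seteqP; split => // w' [/= Bw]; rewrite /y/= /stopped_path ltnn/= => Cw _.
    by apply: BC; rewrite inE /preimage/= history_stopped.
  + exact: measurable_stopped_path.
  + exact: indep_stopped_path.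
Qed.

End Markov.
End StrategicMeasure.

(** * Null sets and one-step marginals under an arbitrary policy *)

Section NullSets.
Context d (T : measurableType d) (R : realType).
Variables (mu : {measure set T -> \bar R}) (N : set T).
Hypotheses (mN : measurable N) (N0 : mu N = 0%E).
Import HBNNSimple.

Let ge0_le_integral_off_null (f g : T -> \bar R) :
  (forall x, 0 <= f x)%E -> (forall x, 0 <= g x)%E ->
  (forall x, ~ N x -> f x = g x) -> (\int[mu]_x f x <= \int[mu]_x g x)%E.
Proof.
move=> f0 g0 fg; rewrite !ge0_integralTE//; apply: ge_ereal_sup => _ [h hf <-].
pose h' := proj_nnsfun h (measurableC mN).
have h'E y : h' y = (h \_ (~` N)) y by rewrite (mrestrict h (measurableC mN)).
have -> : sintegral mu h = sintegral mu h'.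
  rewrite -!integralT_nnsfun; apply: ge0_ae_eq_integral => //.
  - exact/measurable_EFinP.
  - exact/measurable_EFinP.
  - by move=> x _; rewrite lee_fin.
  - by move=> x _; rewrite lee_fin.
  exists N; split => // x /= hx; apply: contrapT => Nx; apply: hx => _.
  rewrite -[RHS]/((h' x)%:E) h'E patchE ifT// inE; exact: Nx.
apply: ereal_sup_ubound; exists h' => //= x.
rewrite -[X in (X <= _)%E]/((h' x)%:E) h'E patchE; case: ifPn => [/set_mem Nx|_ //].
by rewrite -fg.
Qed.

(** No measurability is assumed of f and g. The holding cost is arbitrary
  outside the state space, so the one-step cost may be a non-measurable
  function of the state and action; the integral of a nonnegative function
  being a supremum over the simple functions below it, cutting these to zero
  on N changes neither their integral nor the comparison. *)
Lemma integral_off_null (f g : T -> \bar R) :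
  (forall x, ~ N x -> f x = g x) -> (\int[mu]_x f x = \int[mu]_x g x)%E.
Proof.
move=> fg; rewrite integralE [RHS]integralE.
by congr (_ - _)%E; apply/eqP; rewrite eq_le; apply/andP; split;
  apply: ge0_le_integral_off_null => // x Nx;
  rewrite ?funeposE ?funenegE fg.
Qed.

Lemma ge0_integral_off_null (f g : T -> \bar R) :
  measurable_fun setT f -> measurable_fun setT g ->
  (forall x, 0 <= f x)%E -> (forall x, 0 <= g x)%E ->
  (forall x, ~ N x -> f x <= g x)%E -> (\int[mu]_x f x <= \int[mu]_x g x)%E.
Proof.
move=> mf mg f0 g0 fg; apply: ae_ge0_le_integral => //.
exists N; split => // x /= hx; apply: contrapT => Nx; apply: hx => _.
exact: fg.
Qed.

End NullSets.

Section Marginals.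
Context d (T : measurableType d) (R : realType) (P : probability T R).
Variable M : inventory P.
Local Notation X := (@states R (kind M)).
Local Notation A := (actions (R:=R) (kind M)).
Local Notation D := (demand M 0%N).
Variables (pi : policy R (kind M)) (x : R) (Q : probability (trajectory R) R).
Hypotheses (Xx : X x) (sQ : strategic_measure pi x Q).

Lemma measurable_histories t : measurable (@histories R (kind M) t).
Proof.
pose F (i : 'I_t) := (fun h : history R t => tnth h.1 i) @^-1` (X `*` A).
rewrite (_ : @histories R _ t = \bigcap_(i in [set: 'I_t]) F i `&` snd @^-1` X).
  apply: measurableI; last first.
    by rewrite -[X in measurable X]setTI; apply: measurable_snd => //; exact: measurable_states.
  apply: fin_bigcap_measurable; first exact: finite_finset.
  move=> i _; rewrite -[X in measurable X]setTI.
  apply: (measurableT_comp (@measurable_tnth _ _ t i) measurable_fst) => //.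
  by apply: measurableX; [exact: measurable_states|exact: measurable_actions].
by apply/seteqP; split => h [h1 h2]; split => // i; [move=> _|]; apply: h1.
Qed.

Arguments measurable_histories : clear implicits.

Definition infeasible : set (trajectory R) :=
  [set w | ~ forall t, X (state_at t w) /\ A (action_at t w)].

Let prob1_setC (E F : set (trajectory R)) : measurable E -> measurable F ->
  E `<=` F -> Q E = 1%E -> Q F = 1%E.
Proof.
move=> mE mF EF QE; apply/eqP; rewrite eq_le probability_le1//= -QE.
by apply: le_measure; rewrite ?inE.
Qed.

Let mH t B : measurable B -> measurable [set w : trajectory R | B (history_at t w)].
Proof. by move=> mB; rewrite -[X in measurable X]setTI; exact: measurable_history_at. Qed.

Let mA t C : measurable C -> measurable [set w : trajectory R | C (action_at t w)].
Proof. by move=> mC; rewrite -[X in measurable X]setTI; exact: measurable_action_at. Qed.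

Let mS t C : measurable C -> measurable [set w : trajectory R | C (state_at t w)].
Proof. by move=> mC; rewrite -[X in measurable X]setTI; exact: measurable_state_at. Qed.

Let Hset t := [set w : trajectory R | histories (kind M) (history_at t w)].

Let QH_action t : Q (Hset t) = 1%E ->
  Q [set w | histories (kind M) (history_at t w) /\ A (action_at t w)] = 1%E.
Proof.
move=> QH; have [_ + _] := sQ.
move=> /(_ t _ _ (measurable_histories t) (@measurable_actions R (kind M))) ->.
rewrite -QH -[RHS]mul1e -integral_cst; last by apply: mH; exact: measurable_histories.
apply: eq_integral => w /set_mem; exact: rule_actions.
Qed.

Let QH t : Q (Hset t) = 1%E.
Proof.
elim: t => [|t IH].
  have [Q0 _ _] := sQ; apply: (prob1_setC _ _ _ Q0).
  - by apply: (mS 0 (measurable_set1 x)).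
  - by apply: mH; exact: measurable_histories.
  - by move=> w /= wx; split; [case|move: Xx; rewrite -wx].
have [_ _] := sQ.
move=> /(_ t _ _ _ (measurable_histories t) (@measurable_actions R (kind M))
  (@measurable_states R (kind M))) Q1.
have mHA : measurable [set w : trajectory R |
    histories (kind M) (history_at t w) /\ A (action_at t w)].
  apply: measurableI; [by apply: mH; exact: measurable_histories|].
  by apply: mA; exact: measurable_actions.
have {}Q1 : Q [set w | [/\ histories (kind M) (history_at t w),
    A (action_at t w) & X (state_at t.+1 w)]] = 1%E.
  rewrite Q1 -(QH_action IH) -[RHS]mul1e -integral_cst//.
  apply: eq_integral => w /set_mem[[_ Xt] /actionsE[Xa _]].
  rewrite /transition (_ : _ @^-1` _ = setT) ?probability_setT//.
  apply/seteqP; split => // w' _ /=; apply: statesB; last exact: demand_states.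
  exact: statesD.
apply: (prob1_setC _ _ _ Q1).
- rewrite (_ : [set _ | _] = [set w | histories (kind M) (history_at t w) /\
      A (action_at t w)] `&` [set w | X (state_at t.+1 w)]).
    by apply: measurableI => //; apply: mS; exact: measurable_states.
  by apply/seteqP; split => w; [case|case => -[]].
- by apply: mH; exact: measurable_histories.
- move=> w [[h1 h2] h3 h4]; split => // i; rewrite tnth_mktuple.
  have := ltn_ord i; rewrite ltnS leq_eqVlt => /predU1P[->//|it].
  by have := h1 (Ordinal it); rewrite tnth_mktuple.
Qed.

(** By induction on t: the rules put all their mass on admissible orders at
  histories that are feasible so far, and such an order followed by a demand
  leads to a state again. *)
Lemma infeasible_null : measurable infeasible /\ Q infeasible = 0%E.
Proof.
pose E t := ~` [set w : trajectory R |
   histories (kind M) (history_at t w) /\ A (action_at t w)].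
have mHA t : measurable [set w : trajectory R |
    histories (kind M) (history_at t w) /\ A (action_at t w)].
  apply: measurableI; first by apply: mH; exact: measurable_histories.
  by apply: mA; exact: measurable_actions.
have mE t : measurable (E t) by exact: measurableC.
have -> : infeasible = \bigcup_t E t.
  apply/seteqP; split=> [w /= /existsNP[t ht]|w [t _ /= Et] h].
    by exists t => // -[[_ h1] h2]; apply: ht.
  apply: Et; split; last by have [] := h t.
  split; last by have [] := h t.
  by move=> i; rewrite tnth_mktuple; exact: h.
have QE t : Q (E t) = 0%E by rewrite /E probability_setC// QH_action ?subee.
split; first exact: bigcupT_measurable.
apply: measure_negligible; first exact: bigcupT_measurable.
by apply: negligible_bigcup => t; exists (E t); split => //; exact: QE.
Qed.

Lemma integral_state0 (g : R -> \bar R) : measurable_fun setT g ->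
  (forall y, 0 <= g y)%E -> (\int[Q]_w g (state_at 0 w) = g x)%E.
Proof.
move=> mg g0; have [Q0 _ _] := sQ.
have m0 : measurable [set w : trajectory R | state_at 0 w = x].
  exact: (mS 0 (measurable_set1 x)).
have QN : Q (~` [set w | state_at 0 w = x]) = 0%E.
  by rewrite probability_setC//; move: Q0 => /= ->; rewrite subee.
transitivity (\int[Q]_w cst (g x) w)%E.
  apply: (@integral_off_null _ _ _ _ (~` [set w | state_at 0 w = x])).
  - exact: measurableC.
  - exact: QN.
  - by move=> w /contrapT /= ->.
by rewrite integral_cst// [X in (_ * X)%E](probability_setT Q) mule1.
Qed.

(** The law of the next state is the image of the product of the law of the
  trajectory and the law of the demand: for indicators this is the defining
  property of the strategic measure with trivial conditions on the past, and
  Tonelli does the rest. *)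
Lemma integral_next_state t (g : R -> \bar R) : measurable_fun setT g ->
  (forall y, 0 <= g y)%E ->
  (\int[Q]_w g (state_at t.+1 w) =
   \int[Q]_w \int[P]_w' g (state_at t w + action_at t w - D w')%R)%E.
Proof.
move=> mg g0.
pose F (z : trajectory R * T) := state_at t z.1 + action_at t z.1 - D z.2.
have mF : measurable_fun setT F.
  apply: measurable_funB.
    apply: measurable_funD; apply: measurableT_comp => //.
    exact: measurable_state_at.
    exact: measurable_action_at.
  exact: measurableT_comp.
have mst := @measurable_state_at R t.+1.
rewrite -[LHS](ge0_integral_pushforward mst _ (D:=setT))//.
rewrite [LHS](eq_measure_integral (pushforward (Q \x P)%E F)); last first.
  move=> E mE _.
  have [_ _ /(_ t setT setT E measurableT measurableT mE)] := sQ.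
  rewrite (_ : [set w | [/\ _, _ & _]] = [set w | E (state_at t.+1 w)]); last first.
    by apply/seteqP; split => w; [case|].
  rewrite (_ : [set w | setT _ /\ _] = setT); last by apply/seteqP; split.
  move=> QE; rewrite -[LHS]/(Q [set w | E (state_at t.+1 w)]) QE.
  apply: eq_integral => w _ /=; rewrite /transition; congr (P _).
  by apply/seteqP; split => w'; rewrite /xsection /preimage/= inE.
rewrite ge0_integral_pushforward// preimage_setT fubini_tonelli1//.
  exact: measurableT_comp.
by move=> z; exact: g0.
Qed.

End Marginals.

(** * Lower semicontinuity on a closed set of reals *)

Section LowerSemicontinuity.
Variables (R : realType) (X : set R).
Hypothesis cX : closed X.

Definition lsc_on (f : R -> R) := forall x r, X x -> r < f x ->
  exists2 e : R, 0 < e & forall y, X y -> `|y - x| < e -> r < f y.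

Lemma closed_ballP p : (forall e : R, 0 < e -> exists2 y, X y & `|y - p| < e) -> X p.
Proof.
move=> h; apply: cX => U /nbhs_ballP[e /= e0 pU]; have [y Xy yp] := h e e0.
by exists y; split => //; apply: pU; rewrite /ball/= distrC.
Qed.

(** The form in which lower semicontinuity is used: a bound that holds at
  points of X arbitrarily close to p holds at p. *)
Lemma lsc_cluster (f : R -> R) p r : lsc_on f ->
  (forall e : R, 0 < e -> exists2 y, X y & `|y - p| < e /\ f y <= r) ->
  X p /\ f p <= r.
Proof.
move=> lf h; have Xp : X p.
  by apply: closed_ballP => e e0; have [y Xy []] := h e e0; exists y.
split => //; rewrite leNgt; apply/negP => /(lf _ _ Xp)[e e0 fe].
by have [y Xy [/(fe _ Xy) ry]] := h e e0; rewrite leNgt ry.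
Qed.

Lemma lsc_measurable (f : R -> R) : lsc_on f -> measurable_fun X f.
Proof.
move=> lf; have mX : measurable X by exact: closed_measurable.
apply: (measurability _ (RGenOInfty.measurableE R)) => //.
move=> /= _ [_ [r ->] <-].
rewrite (_ : X `&` _ = X `\` [set x | X x /\ f x <= r]).
  apply: measurableD => //; apply: closed_measurable => p clp.
  apply: (lsc_cluster lf) => e e0.
  have [y [[Xy fy] yp]] := clp _ (nbhsx_ballx p _ e0).
  by exists y => //; split => //; rewrite distrC.
apply/seteqP; split => [x [Xx /=]|x [Xx /= fx]]; rewrite ?in_itv/= ?andbT.
  by move=> rx; split => // -[_]; rewrite leNgt rx.
split => //=; rewrite ?in_itv/= ?andbT ltNge; apply/negP => fxr; exact: fx.
Qed.

(** Bolzano-Weierstrass, stated with frequently recurring indices instead of a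
  subsequence. *)
Lemma cluster_point (y : nat -> R) a b :
  (forall n, X (y n) /\ a <= y n <= b) ->
  exists2 p, X p /\ a <= p <= b &
    forall (e : R) N, 0 < e -> exists2 n, (N <= n)%N & `|y n - p| < e.
Proof.
move=> yab; have /(_ (y @ \oo)) := @segment_compact R a b.
have FF : ProperFilter (y @ \oo) by apply: fmap_proper_filter.
move=> /(_ FF)[].
  by exists 0%N => // n _ /=; rewrite in_itv/=; have [] := yab n.
move=> p [/= pab clp].
have near (e : R) N : 0 < e -> exists2 n, (N <= n)%N & `|y n - p| < e.
  move=> e0; have [] := clp (y @` [set n | (N <= n)%N]) (ball p e).
  - by exists N => // n Nn /=; exists n.
  - exact: nbhsx_ballx.
  - by move=> _ [[n /= Nn <-] yp]; exists n => //; rewrite distrC.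
exists p => //; split; last by move: pab; rewrite in_itv.
by apply: closed_ballP => e e0; have [n _ yn] := near e 0%N e0; exists (y n) => //; have [] := yab n.
Qed.

Lemma lsc_sublevel_inf (f : R -> R) a r : lsc_on f ->
  (exists2 y, X y & a <= y /\ f y <= r) ->
  let q := inf [set y | [/\ X y, a <= y & f y <= r]] in
  [/\ X q, a <= q, f q <= r & forall y, X y -> a <= y -> f y <= r -> q <= y].
Proof.
move=> lf [y0 Xy0 [ay0 fy0]]; set S := [set y | _]; set q := inf S => /=.
have lb : has_lbound S by exists a => y [].
have hS : has_inf S by split; [exists y0|].
have aq : a <= q by apply: lb_le_inf; [exists y0|move=> y []].
have qS y : X y -> a <= y -> f y <= r -> q <= y by move=> *; apply: ge_inf.
have [] := @lsc_cluster f q r lf.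
  move=> e e0; have [y Sy yq] := inf_adherent e0 hS; have [Xy ay fy] := Sy.
  exists y => //; split => //; rewrite ger0_norm ?subr_ge0 ?qS//.
  by rewrite ltrBlDr addrC.
by split.
Qed.

(** Bounded sublevel sets make minimizing sequences cluster, and
  semicontinuity passes the bound to the cluster point. The same argument,
  applied to a sequence along which f tends to -oo, shows first that the
  infimum is finite. *)
Lemma lsc_min (f : R -> R) x : (exists2 y, X y & x <= y) -> lsc_on f ->
  (forall r, exists b, forall y, X y -> x <= y -> f y <= r -> y <= b) ->
  exists2 q, X q /\ x <= q & forall y, X y -> x <= y -> f q <= f y.
Proof.
move=> [y0 Xy0 xy0] lf cf.
have [b hb] := cf (f y0).
have lbd : has_lbound [set f y | y in [set y | X y /\ x <= y]].
  apply: contrapT => nlb.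
  (* an unbounded infimum would give points with f below -n *)
  have low n : exists y, X y /\ x <= y <= b /\ f y <= Num.min (f y0) (- n%:R).
    have /existsNP[r /not_implyP[[y [Xy xy] <-]] /negP hr] :
        ~ lbound [set f y | y in [set y | X y /\ x <= y]]
          (Num.min (f y0) (- n%:R)).
      by move=> lb; apply: nlb; eexists; exact: lb.
    rewrite -ltNge in hr; exists y; split => //; split; last exact: ltW.
    rewrite xy hb//; apply: ltW; apply: lt_le_trans hr _.
    by rewrite ge_min lexx.
  have [y hy] := choice low.
  have [|p [Xp xpb] clp] := @cluster_point y x b.
    by move=> n; have [? []] := hy n.
  have [n hn] : exists n : nat, - n%:R < f p - 1.
    exists (Num.trunc (1 - f p)).+1; rewrite ltrNl opprB.
    exact: truncnS_gt.
  have [|e e0 fe] := lf p (f p - 1) Xp; first by rewrite ltrBlDr ltrDl.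
  have [k nk yk] := clp e n e0.
  have [Xk [_]] := hy k; rewrite le_min => /andP[_ fk].
  have := fe _ Xk yk; apply/negP; rewrite -leNgt (le_trans fk)//.
  by rewrite (le_trans _ (ltW hn))// lerN2 ler_nat.
set S := [set f y | y in _] in lbd.
have hS : has_inf S by split => //; exists (f y0); exists y0.
have mS y : X y -> x <= y -> inf S <= f y.
  by move=> Xy xy; apply: ge_inf => //; exists y.
have app n : exists y, X y /\ x <= y /\ f y <= inf S + n.+1%:R^-1.
  have n0 : 0 < n.+1%:R^-1 :> R by rewrite invr_gt0.
  by have [_ [y [Xy xy] <-] fy] := inf_adherent n0 hS; exists y; split => //; split => //; exact: ltW.
have [y hy] := choice app.
have [b' hb'] := cf (inf S + 1).
have [|p [Xp xpb] clp] := @cluster_point y x b'.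
  move=> n; have [Xn [xn fn]] := hy n; split => //; rewrite xn hb'//.
  by rewrite (le_trans fn)// lerD2l invf_le1// ler1n.
exists p; first by split => //; case/andP: xpb.
move=> z Xz xz; apply: le_trans (mS _ Xz xz); apply/ler_addgt0Pr => e e0.
have [] := @lsc_cluster f p (inf S + e) lf => //.
move=> e' e'0.
have [n hn] : exists n : nat, n.+1%:R^-1 < e.
  exists (Num.trunc e^-1); rewrite invf_plt ?posrE//.
  exact: truncnS_gt.
have [k nk yk] := clp e' n e'0; have [Xk [xk fk]] := hy k.
exists (y k) => //; split => //; rewrite (le_trans fk)// lerD2l.
rewrite (le_trans _ (ltW hn))// lef_pV2 ?posrE// ler_nat.
by rewrite ltnS.
Qed.

Lemma lsc_onD (f g : R -> R) : lsc_on f -> lsc_on g -> lsc_on (fun x => f x + g x).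
Proof.
move=> lf lg x r Xx rfg; pose e := (f x + g x - r) / 2.
have e0 : 0 < e by rewrite /e; lra.
have [|e1 e10 h1] := lf x (f x - e) Xx; first by rewrite ltrBlDr ltrDl.
have [|e2 e20 h2] := lg x (g x - e) Xx; first by rewrite ltrBlDr ltrDl.
exists (Num.min e1 e2); first by rewrite lt_min e10.
move=> y Xy; rewrite lt_min => /andP[y1 y2].
by have := h1 y Xy y1; have := h2 y Xy y2; rewrite /e; lra.
Qed.

Lemma lsc_onZ (a : R) (f : R -> R) : 0 <= a -> lsc_on f -> lsc_on (fun x => a * f x).
Proof.
move=> a0 lf x r Xx; have [->|ane] := eqVneq a 0.
  by rewrite mul0r => r0; exists 1 => // y _ _; rewrite mul0r.
have ap : 0 < a by rewrite lt_neqAle eq_sym ane.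
rewrite -ltr_pdivrMl// => /(lf _ _ Xx)[e e0 he]; exists e => // y Xy yx.
by rewrite -ltr_pdivrMl// he.
Qed.

Lemma lsc_on_linear (a : R) : lsc_on (fun x => a * x).
Proof.
move=> x r Xx rax; pose b := `|a| + 1.
have b0 : 0 < b by rewrite /b; have := normr_ge0 a; lra.
exists ((a * x - r) / b); first by rewrite divr_gt0// subr_gt0.
move=> y _; rewrite ltr_pdivlMr// => yx.
have : `|a * (y - x)| <= `|y - x| * b.
  by rewrite normrM mulrC ler_wpM2l// /b lerDl.
by rewrite ler_norml mulrBr => /andP[]; lra.
Qed.

Lemma lsc_on_cst (a : R) : lsc_on (fun=> a).
Proof. by move=> x r _ ra; exists 1. Qed.

Lemma lsc_on_min (f g : R -> R) : lsc_on f -> lsc_on g ->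
  lsc_on (fun x => Num.min (f x) (g x)).
Proof.
move=> lf lg x r Xx; rewrite lt_min => /andP[rf rg].
have [e1 e10 h1] := lf x r Xx rf; have [e2 e20 h2] := lg x r Xx rg.
exists (Num.min e1 e2); first by rewrite lt_min e10.
move=> y Xy; rewrite !lt_min => /andP[y1 y2].
by rewrite h1// h2.
Qed.

Lemma lsc_on_sup (f : nat -> R -> R) (g : R -> R) : (forall n, lsc_on (f n)) ->
  (forall n x, X x -> f n x <= g x) ->
  (forall x r, X x -> r < g x -> exists n, r < f n x) -> lsc_on g.
Proof.
move=> lf fg gf x r Xx /(gf _ _ Xx)[n /(lf n _ _ Xx)[e e0 he]].
by exists e => // y Xy yx; rewrite (lt_le_trans (he y Xy yx))// fg.
Qed.

End LowerSemicontinuity.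

(** * The holding cost and expectations after one demand *)

Section Holding.
Context d (T : measurableType d) (R : realType) (P : probability T R).
Variable M : inventory P.
Local Notation X := (@states R (kind M)).
Local Notation h := (holding M).

(** Convexity cleared of denominators. *)
Lemma holding_chord x z y : X x -> X z -> X y -> x <= z -> z <= y ->
  (y - x) * h z <= (y - z) * h x + (z - x) * h y.
Proof.
move=> Xx Xz Xy xz zy; have [xy|yx] := ltP x y; last first.
  have [zx yz] : z = x /\ y = x by split; lra.
  by rewrite zx yz !subrr !mul0r addr0.
have yx0 : 0 < y - x by rewrite subr_gt0.
pose l := (y - z) / (y - x).
have l01 : 0 <= l <= 1.
  by rewrite divr_ge0 ?subr_ge0// ?(ltW xy)//= ler_pdivrMr// mul1r lerD2l lerN2.
have zE : l * x + (1 - l) * y = z by rewrite /l; field; lra.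
have := holding_convex Xx Xy l01; rewrite zE => /(_ Xz).
rewrite -(ler_pM2l yx0) => /le_trans; apply.
by rewrite /l le_eqVlt; apply/orP; left; apply/eqP; field; lra.
Qed.

Lemma holding_scale x y : X x -> X y -> 0 <= y -> y <= x ->
  x * h y <= y * h x.
Proof.
move=> Xx Xy y0 yx; have := holding_chord (states0 R (kind M)) Xy Xx y0 yx.
by rewrite holding0 mulr0 add0r !subr0.
Qed.

Lemma holding_scaleN x y : X x -> X y -> y <= 0 -> x <= y ->
  - x * h y <= - y * h x.
Proof.
move=> Xx Xy y0 xy; have := holding_chord Xx Xy (states0 R (kind M)) xy y0.
by rewrite holding0 mulr0 addr0 !sub0r.
Qed.

Lemma holding_mono x y : X x -> X y -> 0 <= y -> y <= x -> h y <= h x.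
Proof.
move=> Xx Xy y0 yx; have hx := holding_ge0 Xx.
have [x0|x0] := ltP 0 x; last by have -> : y = x by lra.
have := holding_scale Xx Xy y0 yx => hxy.
by rewrite -(ler_pM2l x0) (le_trans hxy)// ler_wpM2r.
Qed.

Lemma holding_monoN x y : X x -> X y -> y <= 0 -> x <= y -> h y <= h x.
Proof.
move=> Xx Xy y0 xy; have hx := holding_ge0 Xx.
have [x0|x0] := ltP x 0; last by have -> : y = x by lra.
have := holding_scaleN Xx Xy y0 xy => hxy.
have x0' : 0 < - x by lra.
by rewrite -(ler_pM2l x0') (le_trans hxy)// ler_wpM2r// lerN2.
Qed.



(** The chord through x and x - 1, or through x and x + 1, bounds a convex
  function from below near x by a Lipschitz function. *)
Lemma holding_lsc : lsc_on X h.
Proof.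
move=> x r Xx rh; pose B := h (x - 1) + h (x + 1) + 1.
have X1 := statesB Xx (states1 R (kind M)); have X2 := statesD Xx (states1 R (kind M)).
have h1 := holding_ge0 X1; have h2 := holding_ge0 X2.
have B0 : 0 < B by rewrite /B; lra.
exists ((h x - r) / B); first by rewrite divr_gt0// subr_gt0.
move=> y Xy; rewrite ltr_pdivlMr// => yx.
have hxy : h x <= h y + `|y - x| * B.
  have hx0 := holding_ge0 Xx.
  have [xy|/ltW xy] := leP x y.
    have x1 : x - 1 <= x by lra.
    have := holding_chord X1 Xx Xy x1 xy.
    rewrite ger0_norm ?subr_ge0// /B => H; nra.
  have x1 : x <= x + 1 by lra.
  have := holding_chord Xy Xx X2 xy x1.
  rewrite ler0_norm ?subr_le0// /B => H; nra.
lra.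
Qed.

End Holding.

Section Expectation.
Context d (T : measurableType d) (R : realType) (P : probability T R).
Variable M : inventory P.
Local Notation X := (@states R (kind M)).
Local Notation h := (holding M).
Local Notation D := (demand M 0%N).

(** The functions for which the one-step expectation can be computed with real
  numbers. *)
Definition admissible (v : R -> R) := [/\ lsc_on X v, (forall x, X x -> 0 <= v x) &
  forall x, X x -> P.-integrable setT (EFin \o (fun w => v (x - D w)))].

(** E v (x - D); in particular EXnext h is the expected holding cost. *)
Definition EXnext (v : R -> R) (x : R) : R := \int[P]_w v (x - D w).

Lemma statesBD x w : X x -> X (x - D w).
Proof. by move=> Xx; apply: statesB => //; exact: demand_states. Qed.

Lemma measurable_shift (v : R -> R) x : lsc_on X v -> X x ->
  measurable_fun setT (fun w => v (x - D w)).
Proof.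
move=> lv Xx; apply: (measurable_comp (measurable_states (kind M)) (f := v)
  (g := fun w => x - D w)).
- by move=> _ [w _ <-]; exact: statesBD.
- by apply: lsc_measurable => //; exact: closed_states.
- by apply: measurable_funB => //; exact: measurable_funP.
Qed.

Lemma integral_EXnext v x : admissible v -> X x ->
  (\int[P]_w (v (x - D w))%:E = (EXnext v x)%:E)%E.
Proof.
move=> [_ _ iv] Xx; rewrite /EXnext /Rintegral fineK//.
by apply: integrable_fin_num => //; exact: iv.
Qed.

Lemma EXnext_ge0 v x : admissible v -> X x -> 0 <= EXnext v x.
Proof.
by move=> [_ v0 _] Xx; apply: Rintegral_ge0 => w _; apply: v0; exact: statesBD.
Qed.

(** Monotonicity and linearity of the expectation in one statement, with three
  different states: K-convexity and all the Lipschitz and growth estimates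
  are pointwise inequalities of this form. *)
Lemma EXnext_comb v1 v2 v3 x1 x2 x3 (a1 a2 a3 k : R) :
  admissible v1 -> admissible v2 -> admissible v3 -> X x1 -> X x2 -> X x3 ->
  (forall y, X y -> 0 <= y ->
    a1 * v1 (x1 - y) <= a2 * v2 (x2 - y) + a3 * v3 (x3 - y) + k) ->
  a1 * EXnext v1 x1 <= a2 * EXnext v2 x2 + a3 * EXnext v3 x3 + k.
Proof.
move=> A1 A2 A3 X1 X2 X3 H.
have i1 a v x : admissible v -> X x ->
    P.-integrable setT (EFin \o (fun w => a * v (x - D w))).
  move=> [_ _ iv] Xx; have := integrableZl measurableT a (iv x Xx).
  by apply: eq_integrable => // w _ /=; rewrite EFinM.
have ik : P.-integrable setT (EFin \o (fun _ : T => k)).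
  exact: finite_measure_integrable_cst.
have i2 : P.-integrable setT
    (EFin \o (fun w => a2 * v2 (x2 - D w) + a3 * v3 (x3 - D w))).
  exact: (integrableD measurableT (i1 a2 _ _ A2 X2) (i1 a3 _ _ A3 X3)).
have -> : k = \int[P]_(w in setT) k.
  rewrite Rintegral_cst// -[LHS]mulr1; congr (_ * _).
  by rewrite -[RHS]/(fine (P setT)) probability_setT.
have [_ _ /(_ _ X1) J1] := A1; have [_ _ /(_ _ X2) J2] := A2.
have [_ _ /(_ _ X3) J3] := A3.
rewrite /EXnext -!RintegralZl// -!RintegralD//; try exact: i1.
apply: le_Rintegral => //.
- exact: i1.
- exact: (integrableD measurableT i2 ik).
by move=> w _; apply: H; [exact: demand_states|exact: demand_ge0].
Qed.

Lemma EXnext_le v1 v2 x1 x2 (k : R) : admissible v1 -> admissible v2 -> X x1 -> X x2 ->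
  (forall y, X y -> 0 <= y -> v1 (x1 - y) <= v2 (x2 - y) + k) ->
  EXnext v1 x1 <= EXnext v2 x2 + k.
Proof.
move=> A1 A2 X1 X2 H.
have := @EXnext_comb v1 v2 v2 x1 x2 x2 1 1 0 k A1 A2 A2 X1 X2 X2.
rewrite !mul1r mul0r addr0; apply => y Xy y0.
by rewrite !mul1r mul0r addr0; exact: H.
Qed.

Lemma EXnext_ge_cst v x k : admissible v -> X x ->
  (forall y, X y -> 0 <= y -> k <= v (x - y)) -> k <= EXnext v x.
Proof.
move=> A Xx H.
have := @EXnext_comb v v v x x x 0 1 0 (-k) A A A Xx Xx Xx.
rewrite !mul1r !mul0r addr0 subr_ge0; apply => y Xy y0.
by rewrite mul1r !mul0r addr0 subr_ge0; exact: H.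
Qed.

(** Fatou's lemma along moving states and moving functions. With constant
  functions it gives lower semicontinuity, with constant states it gives
  monotone convergence. *)
Lemma EXnext_fatou (v : R -> R) (vn : nat -> R -> R) x (xn : nat -> R) r :
  admissible v -> (forall n, admissible (vn n)) -> X x -> (forall n, X (xn n)) ->
  (forall y r', X y -> 0 <= y -> r' < v (x - y) ->
     exists N, forall n, (N <= n)%N -> r' < vn n (xn n - y)) ->
  (forall n, EXnext (vn n) (xn n) <= r) -> EXnext v x <= r.
Proof.
move=> Av An Xx Xn H Hr.
rewrite -lee_fin -integral_EXnext//.
pose f n w := (vn n (xn n - D w))%:E.
have mf n : measurable_fun setT (f n).
  by apply/measurable_EFinP; apply: measurable_shift => //; have [] := An n.
have f0 n w : setT w -> (0 <= f n w)%E.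
  move=> _; rewrite lee_fin; have [_ + _] := An n; apply.
  exact: statesBD.
apply: (@le_trans _ _ (\int[P]_w limn_einf (f^~ w))%E).
  apply: ge0_le_integral => //.
  - move=> w _; rewrite lee_fin; have [_ + _] := Av; apply; exact: statesBD.
  - by apply/measurable_EFinP; apply: measurable_shift => //; have [] := Av.
  - apply: measurableT_comp => //.
    apply: (@measurable_fun_limn_esup _ _ _ setT (fun n w => - f n w)%E) => n.
    exact: measurableT_comp.
  move=> w _; apply/lee_subgt0Pr => e e0.
  have [|N hN] := H (D w) (v (x - D w) - e) (demand_states M 0%N w)
    (demand_ge0 M 0%N w); first by rewrite ltrBlDr ltrDl.
  rewrite limn_einf_lim; apply: lime_ge; first exact: is_cvg_einfs.
  exists N => // n /= Nn; apply: le_ereal_inf_tmp => _ [m /= nm <-].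
  by rewrite /f -EFinB lee_fin ltW// hN// (leq_trans Nn).
apply: (le_trans (fatou P measurableT mf f0)).
rewrite limn_einf_lim; apply: lime_le; first exact: is_cvg_einfs.
near=> n; apply: (@le_trans _ _ (\int[P]_w f n w)%E).
  by apply: ereal_inf_lbound; exists n => /=.
by rewrite /f integral_EXnext// lee_fin.
Unshelve. all: by end_near. Qed.

Lemma EXnext_lsc v : admissible v -> lsc_on X (EXnext v).
Proof.
move=> Av x r Xx rv; apply: contrapT => nex.
(* otherwise some sequence tends to x along which the expectation is at most r *)
have bad n : exists y, [/\ X y, `|y - x| < n.+1%:R^-1 & EXnext v y <= r].
  apply: contrapT => hy; apply: nex; exists n.+1%:R^-1; first by rewrite invr_gt0.
  by move=> y Xy yx; rewrite ltNge; apply/negP => ?; apply: hy; exists y.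
have [y hy] := choice bad.
suff : EXnext v x <= r by rewrite leNgt rv.
apply: (@EXnext_fatou v (fun=> v) x y) => //.
- by move=> n; have [] := hy n.
- move=> z r' Xz z0 r'v; have [lv _ _] := Av.
  have [e e0 he] := lv _ _ (statesB Xx Xz) r'v.
  exists (Num.trunc e^-1) => n hn; apply: he.
    by apply: statesB => //; have [] := hy n.
  have -> : y n - z - (x - z) = y n - x by ring.
  have [_ yx _] := hy n; rewrite (lt_le_trans yx)//.
  rewrite invf_ple ?posrE// ltW//; apply: lt_le_trans (truncnS_gt _) _.
  by rewrite ler_nat ltnS.
- by move=> n; have [] := hy n.
Qed.

Lemma admissible_holding : admissible h.
Proof.
have h0 := @holding_ge0 _ _ _ _ M.
split => //; first exact: holding_lsc.
move=> x Xx; apply/integrableP; split.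
  by apply/measurable_EFinP; apply: measurable_shift => //; exact: holding_lsc.
have := holding_mean Xx; rewrite unlock; apply: le_lt_trans.
rewrite le_eqVlt; apply/orP; left; apply/eqP; apply: eq_integral => w _ /=.
by rewrite ger0_norm// h0//; exact: statesBD.
Qed.

Lemma expectation_holding x : X x ->
  ('E_P[fun w => h (x - D w)] = (EXnext h x)%:E)%E.
Proof. by move=> Xx; rewrite unlock integral_EXnext//; exact: admissible_holding. Qed.

End Expectation.

(** * The dynamic programming operator and its iterates *)

Section DynamicProgramming.
Context d (T : measurableType d) (R : realType) (P : probability T R).
Variable M : inventory P.
Variable alpha : R.
Hypothesis alpha01 : 0 <= alpha < 1.
Local Notation X := (@states R (kind M)).
Local Notation h := (holding M).
Local Notation D := (demand M 0%N).
Local Notation K := (setup_cost M).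
Local Notation c := (unit_cost M).
Local Notation EXnext := (EXnext M).

Let alpha0 : 0 <= alpha. Proof. by case/andP: alpha01. Qed.
Let alpha1 : 0 < 1 - alpha. Proof. by rewrite subr_gt0; case/andP: alpha01. Qed.
Let c0 : 0 < c. Proof. exact: unit_cost_gt0. Qed.
Let K0 : 0 < K. Proof. exact: setup_cost_gt0. Qed.
Let X0 : X (0 : R). Proof. exact: states0. Qed.
Let cX : closed (states (R:=R) (kind M)). Proof. exact: closed_states. Qed.

Definition mean_demand : R := \int[P]_w D w.

Lemma integrable_demand : P.-integrable setT (EFin \o D).
Proof.
apply/integrableP; split; first by apply/measurable_EFinP.
have := demand_mean M; rewrite unlock; apply: le_lt_trans.
rewrite le_eqVlt; apply/orP; left; apply/eqP; apply: eq_integral => w _ /=.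
by rewrite ger0_norm//; exact: demand_ge0.
Qed.

Lemma mean_demand_ge0 : 0 <= mean_demand.
Proof. by apply: Rintegral_ge0 => w _; exact: demand_ge0. Qed.

(** The constant is chosen so that (1 - alpha) times it equals K + h y + E h
  (- D) + alpha c E D, the cost of one period plus the discounted cost of
  replacing its demand. *)
Definition cost_bound_pos (y : R) : R :=
  (K + h y + EXnext h 0 + alpha * (c * mean_demand)) / (1 - alpha).

(** A bound for the cost of the policy that orders up to 0 from negative
  levels and does not order otherwise. *)
Definition cost_bound (x : R) : R := cost_bound_pos (Num.max x 0) + c * Num.max (- x) 0.

(** The class of functions in which the iteration takes place. *)
Definition dominated (v : R -> R) :=
  lsc_on X v /\ forall x, X x -> 0 <= v x <= cost_bound x.

Lemma states_max0 x : X x -> X (Num.max x 0).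
Proof. by move=> Xx; rewrite maxEle; case: ifP. Qed.

Lemma cost_bound_shift x y : X x -> X y -> 0 <= y ->
  cost_bound (x - y) <= cost_bound_pos (Num.max x 0) + c * (`|x| + y).
Proof.
move=> Xx Xy y0; apply: lerD.
  rewrite /cost_bound_pos ler_wpM2r ?invr_ge0 ?(ltW alpha1)//.
  rewrite !lerD2r lerD2l; apply: holding_mono.
  - exact: states_max0.
  - by apply: states_max0; exact: statesB.
  - by rewrite le_max lexx orbT.
  - rewrite ge_max; apply/andP; split; last by rewrite le_max lexx orbT.
    by rewrite le_max; apply/orP; left; lra.
rewrite ler_wpM2l ?(ltW c0)// ge_max; apply/andP; split.
  by have := ler_norm (- x); rewrite normrN; lra.
by rewrite addr_ge0.
Qed.

Lemma cost_bound_shift_pos x y : X x -> X y -> 0 <= x -> 0 <= y ->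
  cost_bound (x - y) <= cost_bound_pos x + c * y.
Proof.
move=> Xx Xy x0 y0; apply: lerD.
  rewrite /cost_bound_pos ler_wpM2r ?invr_ge0 ?(ltW alpha1)//.
  rewrite !lerD2r lerD2l; apply: holding_mono => //.
  - by apply: states_max0; exact: statesB.
  - by rewrite le_max lexx orbT.
  - by rewrite ge_max x0 andbT; lra.
by rewrite ler_wpM2l ?(ltW c0)// ge_max y0 andbT; lra.
Qed.

Let integrable_affine (a b : R) : P.-integrable setT (EFin \o (fun w => a + b * D w)).
Proof.
have i1 : P.-integrable setT (EFin \o (fun w => b * D w)).
  have := integrableZl measurableT b integrable_demand.
  by apply: eq_integrable => // w _ /=; rewrite EFinM.
have i2 : P.-integrable setT (EFin \o (fun _ : T => a)).
  exact: finite_measure_integrable_cst.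
exact: (integrableD measurableT i2 i1).
Qed.

Lemma dominated_admissible v : dominated v -> admissible M v.
Proof.
move=> [lv vb]; split => //; first by move=> x /vb/andP[].
move=> x Xx.
apply: (le_integrable measurableT _ _
  (integrable_affine (cost_bound_pos (Num.max x 0) + c * `|x|) c)).
  by apply/measurable_EFinP; exact: measurable_shift.
move=> w _ /=; rewrite lee_fin.
have /andP[v0 vB] := vb _ (statesBD w Xx).
rewrite ger0_norm// (le_trans vB)// (le_trans (cost_bound_shift Xx _ _))//.
- exact: demand_states.
- exact: demand_ge0.
- by rewrite mulrDr addrA ler_norm.
Qed.

Lemma EXnext_dominated_le v x : dominated v -> X x -> 0 <= x ->
  EXnext v x <= cost_bound_pos x + c * mean_demand.
Proof.
move=> gv Xx x0; have [_ _ iv] := dominated_admissible gv.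
apply: (@le_trans _ _ (\int[P]_w (cost_bound_pos x + c * D w))).
  apply: le_Rintegral => //; first exact: iv.
  move=> w _; have [_ /(_ _ (statesBD w Xx))/andP[_]] := gv.
  move=> /le_trans; apply; apply: cost_bound_shift_pos => //.
  - exact: demand_states.
  - exact: demand_ge0.
have i1 : P.-integrable setT (EFin \o (fun w => c * D w)).
  have := integrable_affine 0 c.
  by apply: eq_integrable => // w _ /=; rewrite add0r.
have i2 : P.-integrable setT (EFin \o (fun _ : T => cost_bound_pos x)).
  exact: finite_measure_integrable_cst.
rewrite RintegralD// RintegralZl//; last exact: integrable_demand.
rewrite lerD2r Rintegral_cst//.
by rewrite -[X in _ * X]/(fine (P setT)) probability_setT mulr1.
Qed.

(** Not ordering is affordable at nonnegative levels: as y - D stays below y,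
  the bound only grows by the price of the shortage. *)
Lemma cost_bound_supersol_pos v x : dominated v -> X x -> 0 <= x ->
  EXnext h x + alpha * EXnext v x <= cost_bound x.
Proof.
move=> gv Xx x0; have EXv := EXnext_dominated_le gv Xx x0.
have EXh : EXnext h x <= EXnext h 0 + h x.
  apply: EXnext_le => //; try exact: admissible_holding.
  move=> y Xy y0; rewrite sub0r; have [yx|xy] := leP y x.
    apply: (@le_trans _ _ (h x)).
      by apply: holding_mono => //; [exact: statesB|lra|lra].
    by rewrite lerDr; apply: holding_ge0; exact: statesN.
  apply: (@le_trans _ _ (h (- y))).
    by apply: holding_monoN; [exact: statesN|exact: statesB|lra|lra].
  by rewrite lerDl; exact: holding_ge0.
have bE : cost_bound x = cost_bound_pos x.
  by rewrite /cost_bound max_l// max_r ?mulr0 ?addr0// oppr_le0.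
have bp : (1 - alpha) * cost_bound_pos x =
    K + h x + EXnext h 0 + alpha * (c * mean_demand).
  by rewrite /cost_bound_pos mulrC mulfVK// gt_eqF.
have := ler_wpM2l alpha0 EXv.
have K_gt0 := K0.
by rewrite bE; move: bp; rewrite mulrBl mul1r mulrDr; lra.
Qed.

(** From a negative level an order up to 0 is affordable. *)
Lemma cost_bound_supersol_neg v x : dominated v -> x <= 0 ->
  K + EXnext h 0 + alpha * EXnext v 0 - c * x <= cost_bound x.
Proof.
move=> gv x0; have EXv := EXnext_dominated_le gv X0 (lexx 0).
have bE : cost_bound x = cost_bound_pos 0 - c * x.
  by rewrite /cost_bound max_r// max_l ?mulrN// oppr_ge0.
have bp : (1 - alpha) * cost_bound_pos 0 =
    K + EXnext h 0 + alpha * (c * mean_demand).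
  by rewrite /cost_bound_pos holding0 mulrC mulfVK ?gt_eqF// addr0.
have := ler_wpM2l alpha0 EXv.
have K_gt0 := K0.
by rewrite bE; move: bp; rewrite mulrBl mul1r mulrDr; lra.
Qed.

(** Up to the term - c x, the cost of starting a period at level x after
  ordering and continuing with v. *)
Definition Gf (v : R -> R) (x : R) : R := c * x + EXnext h x + alpha * EXnext v x.
Definition Gmin (v : R -> R) (x : R) : R :=
  inf [set Gf v y | y in [set y | X y /\ x <= y]].
Definition bellman (v : R -> R) (x : R) : R :=
  Num.min (Gf v x) (K + Gmin v x) - c * x.

Lemma EXnext_holding_ge0 x : X x -> 0 <= EXnext h x.
Proof. by move=> Xx; apply: EXnext_ge0 => //; exact: admissible_holding. Qed.

Lemma Gf_ge v x : admissible M v -> X x -> c * x <= Gf v x.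
Proof.
move=> Av Xx; have := EXnext_holding_ge0 Xx; have := mulr_ge0 alpha0 (EXnext_ge0 Av Xx).
by rewrite /Gf; lra.
Qed.

Lemma Gf_lsc v : admissible M v -> lsc_on X (Gf v).
Proof.
move=> Av; apply: lsc_onD; last by apply: lsc_onZ => //; exact: EXnext_lsc.
apply: lsc_onD; last by apply: EXnext_lsc; exact: admissible_holding.
exact: lsc_on_linear.
Qed.

Lemma Gmin_has_inf v x : admissible M v ->
  has_inf [set Gf v y | y in [set y | X y /\ x <= y]].
Proof.
move=> Av; have [y0 Xy0 xy0] := states_above (kind M) x; split; first by exists (Gf v y0), y0.
exists (c * x) => _ [y [Xy xy] <-].
by apply: le_trans (Gf_ge Av Xy); rewrite ler_wpM2l// ltW.
Qed.

Lemma Gmin_le v x y : admissible M v -> X y -> x <= y -> Gmin v x <= Gf v y.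
Proof.
by move=> Av Xy xy; apply: ge_inf; [have [] := Gmin_has_inf x Av|exists y].
Qed.

Lemma Gmin_ge v x r : (forall y, X y -> x <= y -> r <= Gf v y) -> r <= Gmin v x.
Proof.
move=> H; have [y0 Xy0 xy0] := states_above (kind M) x.
by apply: lb_le_inf; [exists (Gf v y0), y0|move=> _ [y [Xy xy] <-]; exact: H].
Qed.

Lemma Gmin_mono v x x' : admissible M v -> x <= x' -> Gmin v x <= Gmin v x'.
Proof. by move=> Av xx'; apply: Gmin_ge => y Xy /(le_trans xx'); exact: Gmin_le. Qed.

(** Moving x to the right only raises the infimum; moving it to the left adds
  points near x, where Gf v is almost at least Gf v x. *)
Lemma Gmin_lsc v : admissible M v -> lsc_on X (Gmin v).
Proof.
move=> Av x r Xx rm; pose r' := (r + Gmin v x) / 2.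
have [rr' r'm] : r < r' /\ r' < Gmin v x by rewrite /r'; split; lra.
have r'G : r' < Gf v x by apply: lt_le_trans r'm _; exact: Gmin_le.
have [e e0 he] := Gf_lsc Av Xx r'G; exists e => // y Xy yx.
apply: lt_le_trans rr' _; apply: Gmin_ge => z Xz yz.
have [xz|zx] := leP x z; first by rewrite (le_trans (ltW r'm))// Gmin_le.
rewrite ltW// he//; move: yx; rewrite !ler0_norm ?subr_le0 ?(ltW zx)//; lra.
Qed.

Lemma Gmin_min v x : admissible M v ->
  exists2 y, X y /\ x <= y & Gf v y <= Gmin v x.
Proof.
move=> Av; have [] := @lsc_min R X cX (Gf v) x (states_above (kind M) x) (Gf_lsc Av).
  move=> r; exists (r / c) => y Xy _ Gr; rewrite ler_pdivlMr// mulrC.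
  by rewrite (le_trans _ Gr)// Gf_ge.
by move=> y [Xy xy] hy; exists y => //; exact: Gmin_ge.
Qed.

(** The infimum is attained (order_targetP): this is the smallest minimizer. *)
Definition order_target (v : R -> R) (x : R) : R :=
  inf [set y | [/\ X y, x <= y & Gf v y <= Gmin v x]].

Lemma order_targetP v x : admissible M v ->
  [/\ X (order_target v x), x <= order_target v x, Gf v (order_target v x) = Gmin v x &
   forall y, X y -> x <= y -> Gf v y <= Gmin v x -> order_target v x <= y].
Proof.
move=> Av; have [y [Xy xy] Gy] := Gmin_min x Av.
have [|X1 X2 X3 X4] := @lsc_sublevel_inf R X cX (Gf v) x (Gmin v x) (Gf_lsc Av).
  by exists y.
by split => //; apply/eqP; rewrite eq_le X3/= Gmin_le.
Qed.

(** If the target of x lies to the right of x' then it is also the target of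
  x'; otherwise it lies to the left of x', hence of its target. *)
Lemma order_target_mono v : admissible M v -> {homo order_target v : x y / x <= y}.
Proof.
move=> Av x x' xx'.
have [X1 X2 X3 X4] := order_targetP x Av; have [X1' X2' X3' X4'] := order_targetP x' Av.
have [lx|gx] := leP x' (order_target v x); last by rewrite (le_trans (ltW gx)).
have mm : Gmin v x = Gmin v x'.
  by apply/eqP; rewrite eq_le Gmin_mono//= -X3 Gmin_le.
by apply: X4 => //; [exact: le_trans X2'|rewrite mm X3'].
Qed.

Definition wait_set v := [set x | X x /\ Gf v x <= K + Gmin v x].

(** Waiting wherever it is optimal. The product with an indicator reduces
  measurability to that of the two factors. *)
Definition best_order v x : R := (order_target v x - x) * \1_(~` wait_set v) x.

(** A monotone function is measurable; this is what makes a selector available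
  without a measurable selection theorem. *)
Lemma measurable_best_order v : admissible M v -> measurable_fun setT (best_order v).
Proof.
move=> Av; have mX := measurable_states (R:=R) (kind M).
apply: measurable_funM.
  apply: measurable_funB => //; apply: nondecreasing_measurable => //.
  exact: order_target_mono.
apply: measurable_indic; apply: measurableC.
rewrite (_ : wait_set v =
  X `&` (fun x => Gf v x <= K + Gmin v x) @^-1` [set true]).
  apply: (@measurable_fun_ler _ _ _ X (Gf v) (fun x => K + Gmin v x)) => //.
    by apply: lsc_measurable => //; exact: Gf_lsc.
  apply: lsc_measurable => //; apply: lsc_onD; first exact: lsc_on_cst.
  exact: Gmin_lsc.
by apply/seteqP; split => x [].
Qed.

Lemma best_order_actions v x : admissible M v -> X x -> actions (kind M) (best_order v x).
Proof.
move=> Av Xx; have [X1 X2 _ _] := order_targetP x Av; apply/actionsE; rewrite /best_order indicE.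
case: (_ \in _); rewrite ?mulr1 ?mulr0; split => //; first exact: statesB.
by rewrite subr_ge0.
Qed.

Definition step_cost (x a : R) : R := (if 0 < a then K else 0) + c * a + EXnext h (x + a).

Lemma step_cost_ge0 x a : X x -> actions (kind M) a -> 0 <= step_cost x a.
Proof.
move=> Xx /actionsE[Xa a0]; apply: addr_ge0; last exact/EXnext_holding_ge0/statesD.
by apply: addr_ge0; [case: ifP => // _; exact: ltW|rewrite mulr_ge0// ltW].
Qed.

Lemma bellman_le v x a : admissible M v -> X x -> actions (kind M) a ->
  bellman v x <= step_cost x a + alpha * EXnext v (x + a).
Proof.
move=> Av Xx /actionsE[Xa a0]; rewrite /bellman /step_cost lerBlDr.
have XD := statesD Xx Xa.
have [ap|an] := ltP 0 a.
  rewrite ge_min; apply/orP; right.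
  apply: (@le_trans _ _ (K + Gf v (x + a))).
    by rewrite lerD2l Gmin_le// lerDl.
  by rewrite /Gf; lra.
have -> : a = 0 by lra.
by rewrite ge_min; apply/orP; left; rewrite /Gf addr0; lra.
Qed.

Lemma bellman_best_order v x : admissible M v -> X x ->
  step_cost x (best_order v x) + alpha * EXnext v (x + best_order v x) = bellman v x.
Proof.
move=> Av Xx; have [X1 X2 X3 X4] := order_targetP x Av.
rewrite /best_order indicE; have [xS|xS] := boolP (_ \in _); last first.
  rewrite mulr0 /step_cost ltxx mulr0 !addr0 add0r.
  move: xS; rewrite notin_setE => /contrapT[_ hx].
  by rewrite /bellman min_l// /Gf; lra.
move: xS; rewrite inE => /= /not_andP[//|/negP]; rewrite -ltNge => hx.
have xy : x + (order_target v x - x) = order_target v x by ring.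
rewrite mulr1 /step_cost xy.
have yx : 0 < order_target v x - x.
  rewrite subr_gt0 lt_neqAle X2 andbT; apply/eqP => xE.
  by move: hx (K0); rewrite -X3 -xE; lra.
rewrite yx /bellman min_r ?(ltW hx)// -X3 /Gf; lra.
Qed.

(** Both bounds come from the definition of the minimum: nonnegativity from G
  v x >= c x, the upper bound from the two special orders considered above. *)
Lemma bellman_dominated v : dominated v -> dominated (bellman v).
Proof.
move=> gv; have Av := dominated_admissible gv; split.
  rewrite /bellman (_ : (fun x => _) = (fun x => Num.min (Gf v x) (K + Gmin v x) + (- c) * x)).
    apply: lsc_onD; last exact: lsc_on_linear.
    apply: lsc_on_min; first exact: Gf_lsc.
    by apply: lsc_onD; [exact: lsc_on_cst|exact: Gmin_lsc].
  by apply/funext => x; rewrite mulNr.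
move=> x Xx; apply/andP; split.
  rewrite /bellman subr_ge0 le_min Gf_ge//=.
  have : c * x <= Gmin v x.
    apply: Gmin_ge => y Xy xy; apply: le_trans (Gf_ge Av Xy).
    by rewrite ler_wpM2l// ltW.
  by have := K0; lra.
rewrite /bellman lerBlDr ge_min; apply/orP; have [x0|x0] := leP 0 x; [left|right].
  by have := cost_bound_supersol_pos gv Xx x0; rewrite /Gf; lra.
have := cost_bound_supersol_neg gv (ltW x0).
have := Gmin_le Av X0 (ltW x0); rewrite /Gf; lra.
Qed.

Lemma Gf_le v v' x : admissible M v -> admissible M v' -> X x ->
  (forall y, X y -> v y <= v' y) -> Gf v x <= Gf v' x.
Proof.
move=> Av Av' Xx vv'; rewrite /Gf lerD2l ler_wpM2l//.
rewrite -[leRHS]addr0; apply: EXnext_le => // y Xy _; rewrite addr0 vv'//.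
exact: statesB.
Qed.

Lemma Gmin_le_mono v v' x : admissible M v -> admissible M v' ->
  (forall y, X y -> v y <= v' y) -> Gmin v x <= Gmin v' x.
Proof.
move=> Av Av' vv'; apply: Gmin_ge => y Xy xy.
by apply: le_trans (Gf_le Av Av' Xy vv'); exact: Gmin_le.
Qed.

Lemma bellman_mono v v' x : admissible M v -> admissible M v' -> X x ->
  (forall y, X y -> v y <= v' y) -> bellman v x <= bellman v' x.
Proof.
move=> Av Av' Xx vv'; rewrite /bellman lerD2r le_min !ge_min.
by rewrite Gf_le//= lerD2l Gmin_le_mono// orbT.
Qed.

Definition viter (t : nat) : R -> R := iter t bellman (fun=> 0).

Lemma viter_dominated t : dominated (viter t).
Proof.
elim: t => [|t IH]; last exact: bellman_dominated.
split; first exact: lsc_on_cst.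
move=> x Xx; rewrite lexx/= /cost_bound addr_ge0//; last first.
  by rewrite mulr_ge0 ?(ltW c0)// le_max lexx orbT.
rewrite /cost_bound_pos divr_ge0 ?(ltW alpha1)// !addr_ge0//.
- exact: ltW.
- by apply: holding_ge0; exact: states_max0.
- exact: EXnext_holding_ge0.
- by rewrite mulr_ge0// mulr_ge0 ?mean_demand_ge0// ltW.
Qed.

Lemma viter_admissible t : admissible M (viter t).
Proof. exact/dominated_admissible/viter_dominated. Qed.

Lemma viter_nd t x : X x -> viter t x <= viter t.+1 x.
Proof.
elim: t x => [|t IH] x Xx; last first.
  by apply: (bellman_mono (viter_admissible t) (viter_admissible t.+1)) => //; exact: viter_admissible.
by have [_ /(_ _ Xx)/andP[]] := viter_dominated 1.
Qed.

Lemma viter_le t t' x : X x -> (t <= t')%N -> viter t x <= viter t' x.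
Proof.
move=> Xx; elim: t' => [|t' IH]; first by rewrite leqn0 => /eqP ->.
by rewrite leq_eqVlt => /predU1P[->//|/IH /le_trans]; apply; exact: viter_nd.
Qed.

Definition vlim x : R := sup (range (viter^~ x)).

Lemma vlim_has_sup x : X x -> has_sup (range (viter^~ x)).
Proof.
move=> Xx; split; first by exists (viter 0 x), 0%N.
by exists (cost_bound x) => _ [t _ <-]; have [_ /(_ _ Xx)/andP[]] := viter_dominated t.
Qed.

Lemma viter_vlim t x : X x -> viter t x <= vlim x.
Proof. by move=> Xx; apply: ub_le_sup; [have [] := vlim_has_sup Xx|exists t]. Qed.

Lemma lt_vlim x r : X x -> r < vlim x -> exists t, r < viter t x.
Proof.
move=> Xx rx; have e0 : 0 < vlim x - r by rewrite subr_gt0.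
have [_ [t _ <-]] := sup_adherent e0 (vlim_has_sup Xx).
by rewrite opprB addrC subrK; exists t.
Qed.

Lemma vlim_le x r : X x -> (forall t, viter t x <= r) -> vlim x <= r.
Proof.
move=> Xx ur; rewrite leNgt; apply/negP => /(lt_vlim Xx)[t].
by rewrite ltNge ur.
Qed.

Lemma vlim_dominated : dominated vlim.
Proof.
split; first by apply: (lsc_on_sup (f := viter)) => [n|n x Xx|x r Xx];
  [have [] := viter_dominated n|exact: viter_vlim|exact: lt_vlim].
move=> x Xx; apply/andP; split; first exact: (viter_vlim 0).
by apply: vlim_le => // t; have [_ /(_ _ Xx)/andP[]] := viter_dominated t.
Qed.

Lemma vlim_admissible : admissible M vlim.
Proof. exact/dominated_admissible/vlim_dominated. Qed.

Lemma Gf_viter_vlim t x : X x -> Gf (viter t) x <= Gf vlim x.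
Proof.
by move=> Xx; apply: Gf_le => //;
  [exact: viter_admissible|exact: vlim_admissible|move=> y; exact: viter_vlim].
Qed.

Lemma Gf_viter_le t t' x : X x -> (t <= t')%N -> Gf (viter t) x <= Gf (viter t') x.
Proof.
by move=> Xx tt'; apply: Gf_le => //;
  [exact: viter_admissible|exact: viter_admissible|move=> y Xy; exact: viter_le].
Qed.

(** Monotone convergence, stated as a bound. *)
Lemma Gf_vlim_le x r : X x -> (forall t, Gf (viter t) x <= r) -> Gf vlim x <= r.
Proof.
move=> Xx ur; have [a0|a0] := eqVneq alpha 0.
  by have := ur 0%N; rewrite /Gf a0 !mul0r.
have ap : 0 < alpha by rewrite lt_neqAle eq_sym a0.
rewrite /Gf -lerBrDl mulrC -ler_pdivlMr//.
apply: (@EXnext_fatou _ _ _ _ M vlim viter x (fun=> x)) => //.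
- exact: vlim_admissible.
- exact: viter_admissible.
- move=> y r' Xy _ /(lt_vlim (statesB Xx Xy))[t ht].
  exists t => n tn; rewrite (lt_le_trans ht)// viter_le//; exact: statesB.
- by move=> t; rewrite ler_pdivlMr// mulrC lerBrDl; exact: ur.
Qed.

(** If points at which the t-th function is at most r accumulate at p, then
  the limit function is at most r at p: for fixed m the functions with t >=
  m dominate the m-th one, which is lower semicontinuous, and then m tends
  to infinity. *)
Lemma Gf_cluster p r (y : nat -> R) :
  (forall (e : R) n, 0 < e -> exists2 k, (n <= k)%N &
     [/\ X (y k), `|y k - p| < e & Gf (viter k) (y k) <= r]) ->
  X p /\ Gf vlim p <= r.
Proof.
move=> clp.
have key m : X p /\ Gf (viter m) p <= r.
  apply: (lsc_cluster cX); first exact/Gf_lsc/viter_admissible.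
  move=> e e0; have [k mk [Xk yk Gk]] := clp e m e0.
  by exists (y k) => //; split => //; apply: le_trans Gk; exact: Gf_viter_le.
have Xp : X p by have [] := key 0%N.
by split => //; apply: Gf_vlim_le => // t; have [] := key t.
Qed.

(** One inequality is monotonicity. For the other one, either waiting stays
  below the limit for all t and monotone convergence applies, or eventually
  ordering is the cheaper option; then the optimal targets from x stay in a
  bounded set, and at a cluster point of them the limit function is as small
  as required. *)
Lemma vlim_fixed x : X x -> bellman vlim x = vlim x.
Proof.
move=> Xx; apply/eqP; rewrite eq_le; apply/andP; split; last first.
  apply: vlim_le => // t; apply: le_trans (viter_nd t Xx) _.
  apply: bellman_mono => //;
  [exact: viter_admissible|exact: vlim_admissible|move=> y; exact: viter_vlim].
rewrite /bellman lerBlDr ge_min; set r := vlim x + _.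
have ur t : Num.min (Gf (viter t) x) (K + Gmin (viter t) x) <= r.
  by have := viter_vlim t.+1 Xx; rewrite /= -/(viter t) /bellman lerBlDr.
apply/orP; have [Gr|/existsNP[t0 /negP]] := pselect (forall t, Gf (viter t) x <= r).
  by left; exact: Gf_vlim_le.
rewrite -ltNge => rG; right.
have mr t : (t0 <= t)%N -> Gmin (viter t) x <= r - K.
  move=> t0t; have := ur t; rewrite ge_min => /orP[|]; last lra.
  by rewrite leNgt (lt_le_trans rG)// Gf_viter_le.
(* targets are indexed from t0 on, where ordering is the cheaper option *)
pose y t := order_target (viter (t0 + t)) x.
have yP t : [/\ X (y t), x <= y t & Gf (viter (t0 + t)) (y t) <= r - K].
  have [Y1 Y2 Y3 _] := order_targetP x (viter_admissible (t0 + t)); split => //.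
  by rewrite Y3 mr// leq_addr.
have [|p [Xp /andP[xp _]] clp] := @cluster_point R X cX y x ((r - K) / c).
  move=> n; have [Y1 Y2 Y3] := yP n; split => //; rewrite Y2/=.
  by rewrite ler_pdivlMr// mulrC (le_trans _ Y3)// Gf_ge//; exact: viter_admissible.
have [] := @Gf_cluster p (r - K) (fun n => y (n - t0)%N).
  move=> e n e0; have [k nk yk] := clp e n e0.
  exists (t0 + k)%N; first by rewrite (leq_trans nk)// leq_addl.
  by rewrite addKn; have [] := yP k.
move=> _ Gp; rewrite -lerBrDl; apply: le_trans Gp.
by apply: Gmin_le => //; exact: vlim_admissible.
Qed.

End DynamicProgramming.

(** * The values of the problems, and optimality of conserving rules *)

Section Verification.
Context d (T : measurableType d) (R : realType) (P : probability T R).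
Variable M : inventory P.
Variable alpha : R.
Hypothesis alpha01 : 0 <= alpha < 1.
Local Notation X := (@states R (kind M)).
Local Notation A := (actions (R:=R) (kind M)).
Local Notation h := (holding M).
Local Notation D := (demand M 0%N).
Local Notation EXnext := (EXnext M).
Local Notation viter := (viter M alpha).
Local Notation vlim := (vlim M alpha).
Local Notation Gf := (Gf M alpha).
Local Notation step_cost := (step_cost M).

Let alpha0 : 0 <= alpha. Proof. by case/andP: alpha01. Qed.

Lemma costE x a : X x -> A a -> cost M x a = (step_cost x a)%:E.
Proof.
move=> Xx /actionsE[Xa _]; rewrite /cost expectation_holding ?EFinD//.
exact: statesD.
Qed.

(** Extended by 0 outside the admissible pairs, where the true cost is
  unconstrained and need not be measurable. *)
Definition pcost : R * R -> R := (fun z => step_cost z.1 z.2) \_ (X `*` A).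
Definition pval (v : R -> R) : R -> R := v \_ X.

Lemma measurable_pval v : lsc_on X v -> measurable_fun setT (pval v).
Proof.
move=> lv; apply: (measurable_restrictT v (measurable_states (kind M))).1.
by apply: lsc_measurable => //; exact: closed_states.
Qed.

Lemma pvalE v x : X x -> pval v x = v x.
Proof. by move=> Xx; rewrite /pval patchE ifT// inE. Qed.

Lemma pval_ge0 v x : (forall y, X y -> 0 <= v y) -> 0 <= pval v x.
Proof.
move=> v0; rewrite /pval patchE; case: ifPn => [/set_mem/v0//|_]; exact: lexx.
Qed.

Lemma measurable_pcost : measurable_fun setT pcost.
Proof.
have mX := @measurable_states R (kind M).
have mA := @measurable_actions R (kind M).
apply: (measurable_restrictT (fun z => step_cost z.1 z.2) (measurableX mX mA)).1.
apply: measurable_funD.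
  apply: measurable_funTS; apply: measurable_funD.
    apply: measurable_fun_ifT => //.
    by apply: measurable_fun_ltr.
  by apply: measurable_funM.
apply: (measurable_comp mX (f := EXnext h) (g := fun z : R * R => z.1 + z.2)).
- by move=> _ [z [Xz /actionsE[Az _]] <-]; exact: statesD.
- apply: lsc_measurable; first exact: closed_states.
  by apply: EXnext_lsc; exact: admissible_holding.
- by apply: measurable_funTS; exact: measurable_funD.
Qed.

Lemma pcostE x a : X x -> A a -> pcost (x, a) = step_cost x a.
Proof. by move=> Xx Aa; rewrite /pcost patchE ifT// inE. Qed.

Lemma pcost_ge0 z : 0 <= pcost z.
Proof.
rewrite /pcost patchE; case: ifPn => [/set_mem[/= Xz Az]|_]; last exact: lexx.
exact: step_cost_ge0.
Qed.

Section Run.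
Variables (pi : policy R (kind M)) (x : R) (Q : probability (trajectory R) R).
Hypotheses (Xx : X x) (sQ : strategic_measure pi x Q).

Definition run_cost (t : nat) : \bar R := (\int[Q]_w (pcost (w t))%:E)%E.
Definition run_val (v : R -> R) (t : nat) : \bar R :=
  (\int[Q]_w (pval v (state_at t w))%:E)%E.

Let mcost t : measurable_fun setT (fun w : trajectory R => (pcost (w t))%:E).
Proof.
apply/measurable_EFinP; apply: (measurableT_comp measurable_pcost).
exact: measurable_coord.
Qed.

Let mval v t : lsc_on X v ->
  measurable_fun setT (fun w : trajectory R => (pval v (state_at t w))%:E).
Proof.
move=> lv; apply/measurable_EFinP; apply: (measurableT_comp (measurable_pval lv)).
exact: measurable_state_at.
Qed.

Let next v t (w : trajectory R) : \bar R :=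
  (\int[P]_w' (pval v (state_at t w + action_at t w - D w')%R)%:E)%E.

Let mnext v t : lsc_on X v -> (forall y, X y -> 0 <= v y) ->
  measurable_fun setT (next v t).
Proof.
move=> lv v0.
pose F (z : trajectory R * T) := state_at t z.1 + action_at t z.1 - D z.2.
have mF : measurable_fun setT F.
  apply: measurable_funB.
    apply: measurable_funD; apply: measurableT_comp => //.
    exact: measurable_state_at.
    exact: measurable_action_at.
  exact: measurableT_comp.
apply: (measurable_fun_fubini_tonelli_F (fun z => (pval v (F z))%:E)).
  by apply/measurable_EFinP; apply: (measurableT_comp (measurable_pval lv)).
by move=> z; rewrite lee_fin pval_ge0.
Qed.

Let nextE v t w : admissible M v -> X (state_at t w) -> A (action_at t w) ->
  next v t w = (EXnext v (state_at t w + action_at t w))%:E.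
Proof.
move=> Av Xt /actionsE[Xa _]; have XD := statesD Xt Xa.
rewrite -integral_EXnext//; apply: eq_integral => w' _.
by rewrite pvalE//; exact: statesBD.
Qed.

Let split_val v t : admissible M v ->
  (run_cost t + alpha%:E * run_val v t.+1 =
   \int[Q]_w ((pcost (w t))%:E + alpha%:E * next v t w))%E.
Proof.
move=> Av; have [lv v0 _] := Av.
rewrite ge0_integralD//; last 3 first.
- by move=> w _; rewrite lee_fin pcost_ge0.
- move=> w _; apply: mule_ge0; first by rewrite lee_fin.
  by apply: integral_ge0 => w' _; rewrite lee_fin pval_ge0.
- by apply: measurable_funeM; exact: mnext.
congr (_ + _)%E; rewrite ge0_integralZl_EFin//; last 2 first.
- by move=> w _; apply: integral_ge0 => w' _; rewrite lee_fin pval_ge0.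
- exact: mnext.
congr (_ * _)%E.
rewrite /run_val.
rewrite (integral_next_state sQ t (g := fun y => (pval v y)%:E))//.
- by apply/measurable_EFinP; exact: measurable_pval.
- by move=> y; rewrite lee_fin pval_ge0.
Qed.

(** One step of the lower bound: the pointwise inequality holds at almost
  every trajectory, whatever the policy. *)
Lemma run_val_le v v' t : admissible M v -> admissible M v' ->
  (forall y a, X y -> A a -> v y <= step_cost y a + alpha * EXnext v' (y + a)) ->
  (run_val v t <= run_cost t + alpha%:E * run_val v' t.+1)%E.
Proof.
move=> Av Av' H; have [lv v0 _] := Av; have [lv' v0' _] := Av'.
rewrite split_val//; have [mN N0] := infeasible_null Xx sQ.
apply: (ge0_integral_off_null mN N0).
- exact: mval.
- by apply: emeasurable_funD => //; apply: measurable_funeM; exact: mnext.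
- by move=> w; rewrite lee_fin pval_ge0.
- move=> w; apply: adde_ge0; first by rewrite lee_fin pcost_ge0.
  apply: mule_ge0; first by rewrite lee_fin.
  by apply: integral_ge0 => w' _; rewrite lee_fin pval_ge0.
move=> w /contrapT /(_ t)[Xt At].
rewrite nextE// -EFinM -EFinD lee_fin pvalE//.
by rewrite [w t]surjective_pairing pcostE//; exact: H.
Qed.

(** One step of the upper bound, valid when the orders actually placed attain
  the minimum off a null set. *)
Lemma run_val_ge v v' t (N : set (trajectory R)) : admissible M v -> admissible M v' ->
  measurable N -> Q N = 0%E ->
  (forall w, ~ N w -> [/\ X (state_at t w), A (action_at t w) &
     step_cost (state_at t w) (action_at t w) +
       alpha * EXnext v' (state_at t w + action_at t w) <= v (state_at t w)]) ->
  (run_cost t + alpha%:E * run_val v' t.+1 <= run_val v t)%E.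
Proof.
move=> Av Av' mN N0 H; have [lv v0 _] := Av; have [lv' v0' _] := Av'.
rewrite split_val//; apply: (ge0_integral_off_null mN N0).
- by apply: emeasurable_funD => //; apply: measurable_funeM; exact: mnext.
- exact: mval.
- move=> w; apply: adde_ge0; first by rewrite lee_fin pcost_ge0.
  apply: mule_ge0; first by rewrite lee_fin.
  by apply: integral_ge0 => w' _; rewrite lee_fin pval_ge0.
- by move=> w; rewrite lee_fin pval_ge0.
move=> w /H[Xt At Hw].
rewrite nextE// -EFinM -EFinD lee_fin pvalE//.
by rewrite [w t]surjective_pairing pcostE.
Qed.

Lemma run_val0 v : admissible M v -> run_val v 0 = (v x)%:E.
Proof.
move=> [lv v0 _]; rewrite /run_val.
rewrite (integral_state0 sQ (g := fun y => (pval v y)%:E)) ?pvalE//.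
- by apply/measurable_EFinP; exact: measurable_pval.
- by move=> y; rewrite lee_fin pval_ge0.
Qed.

Lemma run_cost_ge0 t : (0 <= run_cost t)%E.
Proof. by apply: integral_ge0 => w _; rewrite lee_fin pcost_ge0. Qed.

Lemma run_val_ge0 v t : admissible M v -> (0 <= run_val v t)%E.
Proof.
by move=> [_ v0 _]; apply: integral_ge0 => w _; rewrite lee_fin pval_ge0.
Qed.

(** Telescoping of the one-step inequalities. *)
Lemma run_sum_le (v : nat -> R -> R) n : (forall t, admissible M (v t)) ->
  (forall t, (run_val (v t) t <= run_cost t + alpha%:E * run_val (v t.+1) t.+1)%E) ->
  ((v 0%N x)%:E <= \sum_(t < n) (alpha ^+ t)%:E * run_cost t +
     (alpha ^+ n)%:E * run_val (v n) n)%E.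
Proof.
move=> Av H; elim: n => [|n IH].
  by rewrite big_ord0 add0e expr0 mul1e run_val0.
apply: (le_trans IH); rewrite big_ord_recr/= -addeA leeD2l//.
rewrite exprSr EFinM -muleA -ge0_muleDr ?run_cost_ge0//.
  by apply: lee_wpmul2l; [rewrite lee_fin exprn_ge0|exact: H].
by apply: mule_ge0; [rewrite lee_fin|exact: run_val_ge0].
Qed.

Lemma run_sum_ge (v : nat -> R -> R) n : (forall t, admissible M (v t)) ->
  (forall t, (t < n)%N ->
     (run_cost t + alpha%:E * run_val (v t.+1) t.+1 <= run_val (v t) t)%E) ->
  (\sum_(t < n) (alpha ^+ t)%:E * run_cost t +
     (alpha ^+ n)%:E * run_val (v n) n <= (v 0%N x)%:E)%E.
Proof.
move=> Av; elim: n => [|n IH] H.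
  by rewrite big_ord0 add0e expr0 mul1e run_val0.
apply: le_trans (IH _); last by move=> t tn; apply: H; rewrite ltnS ltnW.
rewrite big_ord_recr/= -addeA leeD2l//.
rewrite exprSr EFinM -muleA -ge0_muleDr ?run_cost_ge0//.
  by apply: lee_wpmul2l; [rewrite lee_fin exprn_ge0|exact: H].
by apply: mule_ge0; [rewrite lee_fin|exact: run_val_ge0].
Qed.

Let stage_costE t w : ~ infeasible M w ->
  stage_cost M alpha t w = ((alpha ^+ t)%:E * (pcost (w t))%:E)%E.
Proof.
move=> /contrapT/(_ t)[Xt At]; rewrite /stage_cost costE//.
by rewrite [w t]surjective_pairing pcostE.
Qed.

Let mstage t : measurable_fun setT
  (fun w : trajectory R => (alpha ^+ t)%:E * (pcost (w t))%:E)%E.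
Proof. exact: measurable_funeM. Qed.

Let stage_ge0 t (w : trajectory R) :
  (0 <= (alpha ^+ t)%:E * (pcost (w t))%:E)%E.
Proof.
by apply: mule_ge0; rewrite lee_fin; [exact: exprn_ge0|exact: pcost_ge0].
Qed.

Let integral_stage t :
  (\int[Q]_w ((alpha ^+ t)%:E * (pcost (w t))%:E) =
   (alpha ^+ t)%:E * run_cost t)%E.
Proof.
rewrite ge0_integralZl_EFin ?exprn_ge0//.
by move=> w _; rewrite lee_fin pcost_ge0.
Qed.

Lemma integral_cost_fin n :
  (\int[Q]_w (\sum_(t < n) stage_cost M alpha t w) =
   \sum_(t < n) (alpha ^+ t)%:E * run_cost t)%E.
Proof.
have [mN N0] := infeasible_null Xx sQ.
rewrite (integral_off_null mN N0
  (g := fun w => (\sum_(t < n) (alpha ^+ t)%:E * (pcost (w t))%:E)%E)).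
  rewrite ge0_integral_sum//; first by apply: eq_bigr => t _; exact: integral_stage.
by move=> w Nw; apply: eq_bigr => t _; exact: stage_costE.
Qed.

Lemma integral_cost_inf :
  (\int[Q]_w (\sum_(0 <= t <oo) stage_cost M alpha t w) =
   \sum_(0 <= t <oo) (alpha ^+ t)%:E * run_cost t)%E.
Proof.
have [mN N0] := infeasible_null Xx sQ.
rewrite (integral_off_null mN N0
  (g := fun w => (\sum_(0 <= t <oo) (alpha ^+ t)%:E * (pcost (w t))%:E)%E)).
  rewrite integral_nneseries//; first by apply: eq_eseriesr => t _; exact: integral_stage.
by move=> w Nw; apply: eq_eseriesr => t _; exact: stage_costE.
Qed.

Lemma stage_term_ge0 t : (0 <= (alpha ^+ t)%:E * run_cost t)%E.
Proof.
by apply: mule_ge0; [rewrite lee_fin exprn_ge0|exact: run_cost_ge0].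
Qed.

(** Telescoping with the iterates in reverse order, the one for the remaining
  horizon at each time. *)
Lemma cost_fin_ge n :
  ((viter n x)%:E <= \int[Q]_w (\sum_(t < n) stage_cost M alpha t w))%E.
Proof.
rewrite integral_cost_fin.
have Av t := viter_admissible M alpha01 t.
have := @run_sum_le (fun t => viter (n - t)) n (fun t => Av (n - t)%N).
rewrite subn0 subnn.
have -> : run_val (viter 0) n = 0%E.
  by apply: integral0_eq => w _; rewrite /pval patchE; case: ifP.
rewrite mule0 adde0; apply => t; apply: run_val_le => // y a Xy Aa.
have [nt|tn] := leqP n t.
  have -> : (n - t = 0)%N by apply/eqP; rewrite subn_eq0.
  have /actionsE[Xa a0] := Aa.
  by rewrite addr_ge0 ?step_cost_ge0// mulr_ge0// EXnext_ge0//; exact: statesD.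
by rewrite -(subnSK tn); exact: bellman_le.
Qed.

(** Costs are nonnegative, so the infinite-horizon cost is at least every
  finite-horizon one. *)
Lemma cost_inf_ge :
  ((vlim x)%:E <= \int[Q]_w (\sum_(0 <= t <oo) stage_cost M alpha t w))%E.
Proof.
apply/lee_subgt0Pr => e e0.
have [t ht] : exists t, vlim x - e < viter t x.
  by apply: lt_vlim => //; rewrite ltrBlDr ltrDl.
apply: (@le_trans _ _ (viter t x)%:E); first by rewrite -EFinB lee_fin ltW.
apply: le_trans (cost_fin_ge t) _; rewrite integral_cost_fin integral_cost_inf.
have := @nneseries_lim_ge R (fun t => (alpha ^+ t)%:E * run_cost t)%E xpredT 0 t.
by rewrite big_mkord; apply => n _ _; exact: stage_term_ge0.
Qed.

End Run.

Section MarkovPolicies.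
Variable phi : nat -> R -> R.
Hypothesis mphi : forall t, measurable_fun setT (phi t).
Hypothesis phiA : forall t y, X y -> A (phi t y).

Let mphi_hist t : measurable_fun setT (fun h : t.-tuple (R * R) * R => phi t h.2).
Proof. exact: measurableT_comp. Qed.

Definition markov_rule (t : nat) : R.-pker (t.-tuple (R * R) * R) ~> R :=
  kdirac (@mphi_hist t).

Lemma markov_rule_actions t (hist : history R t) :
  histories (kind M) hist -> markov_rule t hist A = 1%E.
Proof.
move=> [_ Xh]; rewrite /markov_rule /kdirac/= diracE mem_set//.
exact: phiA.
Qed.

Definition markov_policy : policy R (kind M) := Policy markov_rule_actions.

Variables (x : R) (Xx : X x).

Local Notation Q := (path_law M mphi x).

Lemma strategic_markov : strategic_measure markov_policy x Q.
Proof. by apply: strategic_path_law. Qed.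

Definition bad_action : set (trajectory R) :=
  \bigcup_t [set w | action_at t w != phi t (state_at t w)].

(** The image measure does not charge trajectories whose orders deviate from
  the rule: no demand path produces one. *)
Lemma bad_action_null : measurable (infeasible M `|` bad_action) /\
  Q (infeasible M `|` bad_action) = 0%E.
Proof.
have [mN N0] := infeasible_null Xx strategic_markov.
have mB : measurable bad_action.
  apply: bigcupT_measurable => t.
  have m1 := @measurable_action_at R t; have m2 := @measurable_state_at R t.
  have : measurable_fun setT (fun w : trajectory R =>
    action_at t w == phi t (state_at t w)).
    by apply: measurable_fun_eqr => //; exact: measurableT_comp.
  move=> /(_ measurableT [set false] I); rewrite setTI.
  rewrite (_ : _ @^-1` _ = [set w | action_at t w != phi t (state_at t w)])//.
  by apply/seteqP; split => w /=; case: eqP.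
split; first exact: measurableU.
have B0 : Q bad_action = 0%E.
  rewrite -[LHS]/(P (traj M phi x @^-1` bad_action)).
  rewrite (_ : _ @^-1` _ = set0) ?measure0//.
  by apply/seteqP; split => // w [t _ /=]; rewrite path_law_action eqxx.
apply/eqP; rewrite eq_le measure_ge0 andbT.
have <- : (Q (infeasible M) + Q bad_action = 0)%E by rewrite N0 B0 adde0.
exact: measureU2.
Qed.

Lemma markov_val_ge v v' t : admissible M v -> admissible M v' ->
  (forall y, X y -> step_cost y (phi t y) + alpha * EXnext v' (y + phi t y) <= v y) ->
  (run_cost Q t + alpha%:E * run_val Q v' t.+1 <= run_val Q v t)%E.
Proof.
move=> Av Av' H; have [mN N0] := bad_action_null.
apply: (run_val_ge strategic_markov Av Av' mN N0) => w /not_orP[/contrapT /(_ t)[Xt At]].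
move=> nb; have wE : action_at t w = phi t (state_at t w).
  by apply/eqP; apply: contrapT => /negP ne; apply: nb; exists t.
by split => //; rewrite wE; exact: H.
Qed.

End MarkovPolicies.

Lemma expect_le (pi : policy R (kind M)) x F (Q : probability (trajectory R) R) r :
  strategic_measure pi x Q -> (\int[Q]_w F w <= r)%E -> (expect pi x F <= r)%E.
Proof.
by move=> sQ; apply: le_trans; apply: ereal_inf_lbound; exists Q.
Qed.

Lemma policy_value_fin_ge N (pi : policy R (kind M)) x : X x ->
  ((viter N x)%:E <= policy_value_fin alpha N pi x)%E.
Proof.
by move=> Xx; apply: le_ereal_inf_tmp => _ [Q sQ <-]; exact: (cost_fin_ge Xx sQ).
Qed.

Lemma policy_value_ge (pi : policy R (kind M)) x : X x ->
  ((vlim x)%:E <= policy_value alpha pi x)%E.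
Proof.
by move=> Xx; apply: le_ereal_inf_tmp => _ [Q sQ <-]; exact: (cost_inf_ge Xx sQ).
Qed.

Lemma value_finE N x : X x -> value_fin M alpha N x = (viter N x)%:E.
Proof.
move=> Xx; apply/eqP; rewrite eq_le; apply/andP; split; last first.
  by apply: le_ereal_inf_tmp => _ [pi _ <-]; exact: policy_value_fin_ge.
have Av t := viter_admissible M alpha01 t.
(* after t + 1 periods N - (t + 1) remain *)
pose ph t := best_order M alpha (viter (N - t.+1)).
have mph t : measurable_fun setT (ph t) by exact: measurable_best_order.
have phA t y : X y -> A (ph t y) by move=> Xy; apply: best_order_actions.
have sQ := strategic_markov mph phA Xx.
apply: (@le_trans _ _ (policy_value_fin alpha N (markov_policy mph phA) x)).
  by apply: ereal_inf_lbound; exists (markov_policy mph phA).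
apply: (expect_le sQ); rewrite (integral_cost_fin Xx sQ).
have := @run_sum_ge _ _ _ Xx sQ (fun t => viter (N - t)) N (fun t => Av (N - t)%N).
rewrite subn0 subnn => H; apply: le_trans (H _); last first.
  move=> t tN; apply: markov_val_ge => // y Xy.
  by rewrite /ph -(subnSK tN) bellman_best_order.
rewrite leeDl//; apply: mule_ge0; first by rewrite lee_fin exprn_ge0.
exact: run_val_ge0.
Qed.

(** By bellman_le and vlim_fixed the inequality is an equality: the rule
  attains the minimum in the optimality equation. *)
Definition conserving (ph : R -> R) := measurable_fun setT ph /\
  forall x, X x -> A (ph x) /\ step_cost x (ph x) + alpha * EXnext vlim (x + ph x) <= vlim x.

(** Telescoping gives that the cost of n periods plus a nonnegative remainder
  is at most vlim x; the remainder is dropped and n tends to infinity. *)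
Lemma conserving_value ph : conserving ph ->
  exists2 pi : policy R (kind M), stationary_with ph pi &
    forall x, X x -> (policy_value alpha pi x <= (vlim x)%:E)%E.
Proof.
move=> [mph' Hph]; have mph (t : nat) := mph'.
have phA (t : nat) y : X y -> A (ph y) by move=> /Hph[].
exists (markov_policy mph phA); first by [].
move=> x Xx; have sQ := strategic_markov mph phA Xx.
apply: (expect_le sQ); rewrite (integral_cost_inf Xx sQ).
apply: lime_le; first by apply: is_cvg_nneseries => n _ _; exact: stage_term_ge0.
apply: nearW => n; rewrite big_mkord.
have Au := vlim_admissible M alpha01.
have := @run_sum_ge _ _ _ Xx sQ (fun t => vlim) n (fun t => Au).
move=> H; apply: le_trans (H _); last first.
  by move=> t tN; apply: markov_val_ge => // y /Hph[].
rewrite leeDl//; apply: mule_ge0; first by rewrite lee_fin exprn_ge0.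
exact: run_val_ge0.
Qed.

Lemma conserving_best_order : conserving (best_order M alpha vlim).
Proof.
have Au := vlim_admissible M alpha01.
split; first exact: measurable_best_order.
move=> x Xx; split; first exact: best_order_actions.
by rewrite bellman_best_order// vlim_fixed.
Qed.

Lemma valueE x : X x -> value M alpha x = (vlim x)%:E.
Proof.
move=> Xx; apply/eqP; rewrite eq_le; apply/andP; split; last first.
  by apply: le_ereal_inf_tmp => _ [pi _ <-]; exact: policy_value_ge.
have [pi _ /(_ x Xx)] := conserving_value conserving_best_order.
by apply: le_trans; apply: ereal_inf_lbound; exists pi.
Qed.

Lemma conserving_optimal ph : conserving ph -> stationary_optimal M alpha ph.
Proof.
move=> /conserving_value[pi spi vpi]; exists pi => // x Xx.
by apply/eqP; rewrite eq_le valueE// vpi//= policy_value_ge.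
Qed.

Lemma G_finE t x : X x -> G_fin M alpha t x = (Gf (viter t) x)%:E.
Proof.
move=> Xx; rewrite /G_fin /G_of expectation_holding//.
rewrite (eq_integral (fun w => (viter t (x - D w))%:E)); last first.
  by move=> w _; rewrite value_finE//; exact: statesBD.
by rewrite integral_EXnext//; exact: viter_admissible.
Qed.

Lemma G_infE x : X x -> G_inf M alpha x = (Gf vlim x)%:E.
Proof.
move=> Xx; rewrite /G_inf /G_of expectation_holding//.
rewrite (eq_integral (fun w => (vlim (x - D w))%:E)); last first.
  by move=> w _; rewrite valueE//; exact: statesBD.
by rewrite integral_EXnext//; exact: vlim_admissible.
Qed.

End Verification.

(** * K-convexity and (s, S) rules *)

Section KConvexity.
Context d (T : measurableType d) (R : realType) (P : probability T R).
Variable M : inventory P.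
Variable alpha : R.
Hypothesis alpha01 : 0 <= alpha < 1.
Local Notation X := (@states R (kind M)).
Local Notation h := (holding M).
Local Notation K := (setup_cost M).
Local Notation c := (unit_cost M).
Local Notation EXnext := (EXnext M).
Local Notation viter := (viter M alpha).
Local Notation vlim := (vlim M alpha).
Local Notation Gf := (Gf M alpha).
Local Notation Gmin := (Gmin M alpha).
Local Notation bellman := (bellman M alpha).
Local Notation step_cost := (step_cost M).

Let alpha0 : 0 <= alpha. Proof. by case/andP: alpha01. Qed.
Let K0 : 0 < K. Proof. exact: setup_cost_gt0. Qed.

(** Scarf's K-convexity on X, cleared of denominators. *)
Definition kconvex (f : R -> R) := forall x z y, X x -> X z -> X y ->
  x <= z -> z <= y ->
  (y - x) * f z <= (y - z) * f x + (z - x) * (f y + K).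

(** The linear and the holding terms are convex, and discounting reduces the
  constant K carried by v. *)
Lemma kconvex_Gf v : admissible M v -> kconvex v -> kconvex (Gf v).
Proof.
move=> Av kv x z y Xx Xz Xy xz zy.
have Eh : (y - x) * EXnext h z <= (y - z) * EXnext h x + (z - x) * EXnext h y + 0.
  apply: EXnext_comb => //; try exact: admissible_holding.
  move=> w Xw _.
  have := @holding_chord _ _ _ _ M (x - w) (z - w) (y - w)
    (statesB Xx Xw) (statesB Xz Xw) (statesB Xy Xw).
  rewrite !lerD2r addr0 => /(_ xz zy).
  have -> : y - w - (x - w) = y - x by ring.
  have -> : y - w - (z - w) = y - z by ring.
  by have -> : z - w - (x - w) = z - x by ring.
have Ev : (y - x) * EXnext v z <=
    (y - z) * EXnext v x + (z - x) * EXnext v y + (z - x) * K.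
  apply: EXnext_comb => // w Xw _.
  have := kv (x - w) (z - w) (y - w)
    (statesB Xx Xw) (statesB Xz Xw) (statesB Xy Xw).
  rewrite !lerD2r => /(_ xz zy).
  have -> : y - w - (x - w) = y - x by ring.
  have -> : y - w - (z - w) = y - z by ring.
  have -> : z - w - (x - w) = z - x by ring.
  by rewrite mulrDr addrA.
have zx : 0 <= (z - x) * K by rewrite mulr_ge0 ?subr_ge0// ltW.
have aK : alpha * ((z - x) * K) <= (z - x) * K.
  by rewrite ler_piMl//; case/andP: alpha01 => _ /ltW.
have aEv := ler_wpM2l alpha0 Ev.
rewrite /Gf; move: Eh aEv aK; rewrite !mulrDr; lra.
Qed.

(** The arithmetic core of Scarf's induction. Here a is the best cost from x,
  reached at x', and b is K plus the cost at y', the best level from y. If b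
  <= a then the bound b at z suffices; otherwise more weight on the smaller
  value a is wanted, and the weight of x' in the chord from x' to y' at z is
  at least that of x in the chord from x to y. *)
Lemma kconvex_step (x z y x' y' a Gz Gx' Wz b : R) :
  x <= z -> z <= y -> y <= y' -> x <= x' -> x' <= z ->
  Gx' <= a -> Wz <= Gz -> Wz <= b ->
  (y' - x') * Gz <= (y' - z) * Gx' + (z - x') * b ->
  (y - x) * Wz <= (y - z) * a + (z - x) * b.
Proof.
move=> xz zy yy' xx' x'z Ga WG Wb H.
have [ba|ab] := leP b a.
  have H1 : 0 <= (y - z) * (a - b) by rewrite mulr_ge0 ?subr_ge0.
  have H2 : 0 <= (y - x) * (b - Wz) by rewrite mulr_ge0 ?subr_ge0//; lra.
  nra.
have [Wa|aW] := leP Wz a.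
  have H1 : 0 <= (z - x) * (b - a) by rewrite mulr_ge0 ?subr_ge0// ltW.
  have H2 : 0 <= (y - x) * (a - Wz) by rewrite mulr_ge0 ?subr_ge0//; lra.
  nra.
pose g := Wz - a; pose e := b - a.
have g0 : 0 < g by rewrite /g; lra.
have ge : g <= e by rewrite /g /e; lra.
have Hg : (y - x') * g <= (z - x') * e.
  have H1 : 0 <= (y' - z) * (a - Gx') by rewrite mulr_ge0 ?subr_ge0//; lra.
  have H2 : 0 <= (y' - x') * (Gz - Wz) by rewrite mulr_ge0 ?subr_ge0//; lra.
  have H3 : 0 <= (y' - y) * g by rewrite mulr_ge0 ?subr_ge0// ltW.
  rewrite /g /e in H3 *; nra.
have H4 : 0 <= (x' - x) * (e - g) by rewrite mulr_ge0 ?subr_ge0.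
rewrite /g /e in Hg H4; nra.
Qed.

(** For x < z < y compare the decision at z with the optimal ones at x and y.
  Ordering from z up to the level chosen at y is always possible; if the
  level chosen at x is to the right of z it can be used as well, and
  otherwise K-convexity on the chord between the two chosen levels applies. *)
Lemma kconvex_bellman v : admissible M v -> kconvex (Gf v) -> kconvex (bellman v).
Proof.
move=> Av kG x z y Xx Xz Xy xz zy.
pose W x := Num.min (Gf v x) (K + Gmin v x).
have WE t : bellman v t = W t - c * t by [].
suff H : (y - x) * W z <= (y - z) * W x + (z - x) * (W y + K).
  by rewrite !WE; move: H; lra.
have [y' [Xy' yy' Gy']] : exists y', [/\ X y', y <= y' & Gf v y' <= W y].
  rewrite /W; case: leP => _; first by exists y.
  have [Y1 Y2 Y3 _] := order_targetP alpha01 y Av; exists (order_target M alpha v y).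
  by rewrite Y3; split => //; rewrite lerDr ltW.
pose b := Gf v y' + K.
have Wb : W z <= b.
  rewrite /W ge_min; apply/orP; right; rewrite /b addrC lerD2r.
  by apply: Gmin_le => //; exact: le_trans yy'.
have WG : W z <= Gf v z by rewrite /W ge_min lexx.
suff : (y - x) * W z <= (y - z) * W x + (z - x) * b.
  move=> /le_trans; apply; rewrite lerD2l ler_wpM2l ?subr_ge0//.
  by rewrite /b lerD2r.
have [Wx|Wx] := leP (Gf v x) (K + Gmin v x).
  have WxE : W x = Gf v x by rewrite /W min_l.
  rewrite WxE; apply: (@kconvex_step x z y x y' _ (Gf v z) (Gf v x)) => //.
  by apply: kG => //; exact: le_trans yy'.
have [Y1 Y2 Y3 _] := order_targetP alpha01 x Av; set x' := order_target _ _ _ _ in Y1 Y2 Y3.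
have WxE : W x = K + Gf v x' by rewrite /W min_r ?Y3// ltW.
have [zx'|x'z] := leP z x'.
  have Wa : W z <= W x.
    rewrite WxE /W ge_min lerD2l; apply/orP; right; exact: Gmin_le.
  have H1 : 0 <= (y - z) * (W x - W z) by rewrite mulr_ge0 ?subr_ge0.
  have H2 : 0 <= (z - x) * (b - W z) by rewrite mulr_ge0 ?subr_ge0.
  nra.
rewrite WxE; apply: (@kconvex_step x z y x' y' _ (Gf v z) (Gf v x')) => //.
- exact: ltW.
- by rewrite lerDr ltW.
- by apply: kG => //; [exact: ltW|exact: le_trans yy'].
Qed.

Lemma kconvex_viter t : kconvex (viter t).
Proof.
elim: t => [|t IH].
  move=> x z y _ _ _ xz _; rewrite /= !mulr0 !add0r.
  by rewrite mulr_ge0 ?subr_ge0// ltW.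
have Au := viter_admissible M alpha01 t.
exact/kconvex_bellman/kconvex_Gf.
Qed.

Lemma kconvex_vlim : kconvex vlim.
Proof.
move=> x z y Xx Xz Xy xz zy.
have [xy|] := ltP x y; last first.
  move=> yx; have [-> ->] : z = x /\ y = x by split; lra.
  by rewrite !subrr !mul0r addr0.
have yx0 : 0 < y - x by rewrite subr_gt0.
rewrite mulrC -ler_pdivlMr//; apply: (vlim_le alpha01 Xz) => t.
rewrite ler_pdivlMr// mulrC; apply: (le_trans (kconvex_viter t Xx Xz Xy xz zy)).
apply: lerD; rewrite ler_wpM2l ?subr_ge0// ?lerD2r; exact: viter_vlim.
Qed.

Lemma kconvex_Gviter t : kconvex (Gf (viter t)).
Proof. by apply: kconvex_Gf; [exact: viter_admissible|exact: kconvex_viter]. Qed.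

Lemma kconvex_Gvlim : kconvex (Gf vlim).
Proof. by apply: kconvex_Gf; [exact: vlim_admissible|exact: kconvex_vlim]. Qed.

Definition minimizer (G : R -> R) S := X S /\ forall y, X y -> G S <= G y.

(** K-convexity on the chord from q to S bounds G by K + G S between q and S;
  beyond S, the chord from S to y compares G x with K + G y because G S <= G
  y. *)
Lemma wait_above (G : R -> R) S q x y : kconvex G -> minimizer G S ->
  X q -> q <= S -> G q <= K + G S -> X x -> X y -> q <= x -> x <= y ->
  G x <= K + G y.
Proof.
move=> kG [XS minS] Xq qS Gq Xx Xy qx xy.
have GSy := minS y Xy; have K_gt0 := K0.
have [xS|Sx] := leP x S.
  have [qS'|Sq] := ltP q S; last first.
    have -> : x = S by lra.
    lra.
  have := kG q x S Xq Xx XS qx xS.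
  have H1 : 0 <= (S - x) * (K + G S - G q) by rewrite mulr_ge0 ?subr_ge0.
  have Sq : 0 < S - q by lra.
  move=> H; have : (S - q) * G x <= (S - q) * (K + G S) by nra.
  by rewrite ler_pM2l// => ?; lra.
have := kG S x y XS Xx Xy (ltW Sx) xy.
have H1 : 0 <= (y - x) * (K + G y - G S) by rewrite mulr_ge0 ?subr_ge0//; lra.
have yS : 0 < y - S by lra.
move=> H; have : (y - S) * G x <= (y - S) * (K + G y) by nra.
by rewrite ler_pM2l.
Qed.

(** The hypotheses say exactly that ordering to S is best to the left of s and
  that waiting is best to the right of it. *)
Lemma sS_conserving s S : s <= S -> minimizer (Gf vlim) S ->
  (forall x, X x -> x < s -> K + Gf vlim S <= Gf vlim x) ->
  (forall x y, X x -> X y -> s <= x -> x <= y -> Gf vlim x <= K + Gf vlim y) ->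
  conserving M alpha (sS_rule s S).
Proof.
move=> sS [XS minS] Hlow Hhigh; have Au := vlim_admissible M alpha01.
split.
  apply: measurable_fun_ifT => //.
    by apply: (measurable_fun_ltr (f := id) (g := fun=> s)).
  exact: measurable_funB.
move=> x Xx; have K_gt0 := K0; rewrite /sS_rule; case: ltP => xs.
  have xS : 0 < S - x by lra.
  split; first by apply/actionsE; split; [exact: statesB|exact: ltW].
  rewrite -[leRHS](vlim_fixed alpha01 Xx) /bellman lerBrDr.
  have xSE : x + (S - x) = S by ring.
  have -> : step_cost x (S - x) + alpha * EXnext vlim (x + (S - x)) + c * x = K + Gf vlim S.
    by rewrite /step_cost xS xSE /Gf; ring.
  rewrite le_min Hlow//= lerD2l; apply: Gmin_ge => y Xy _; exact: minS.
split; first by apply/actionsE; split => //; exact: states0.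
rewrite -[leRHS](vlim_fixed alpha01 Xx) /bellman lerBrDr.
have -> : step_cost x 0 + alpha * EXnext vlim (x + 0) + c * x = Gf vlim x.
  by rewrite /step_cost ltxx addr0 /Gf; ring.
rewrite le_min lexx/= addrC -lerBlDr; apply: Gmin_ge => y Xy xy.
by rewrite lerBlDr addrC; exact: Hhigh.
Qed.

(** Only the left end is constrained: at the right end Gf v tends to infinity
  in any case, being at least c x. *)
Definition coercive (G : R -> R) := forall r, exists B, forall y, X y -> G y <= r -> B <= y.

(** Coercivity bounds the sublevel set from below, and lower semicontinuity
  puts its infimum into it. *)
Lemma reorder_levelP (Ge : R -> \bar R) (G : R -> R) S :
  (forall x, X x -> Ge x = (G x)%:E) -> lsc_on X G -> coercive G -> X S ->
  exists q, [/\ reorder_level M Ge S = q%:E, X q, q <= S, G q <= K + G S &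
    forall y, X y -> y < q -> K + G S < G y].
Proof.
move=> GeE lG cG XS; have [B HB] := cG (K + G S).
have GSK : G S <= K + G S by rewrite lerDr; exact: ltW.
have [|X1 X2 X3 X4] := @lsc_sublevel_inf R X (closed_states (k:=kind M)) G B (K + G S) lG.
  by exists S => //; split => //; exact: HB.
set q := inf _ in X1 X2 X3 X4; exists q.
have qlow y : X y -> G y <= K + G S -> q <= y by move=> Xy Gy; apply: X4 => //; exact: HB.
split => //; last 2 first.
- exact: qlow.
- by move=> y Xy yq; rewrite ltNge; apply/negP => /(qlow y Xy); rewrite leNgt yq.
apply/eqP; rewrite eq_le; apply/andP; split.
  apply: ereal_inf_lbound; exists q => //; split => //; first exact: qlow.
  by rewrite !GeE// -EFinD lee_fin.
apply: le_ereal_inf_tmp => _ [y [Xy yS Gy] <-].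
by move: Gy; rewrite !GeE// -EFinD !lee_fin; exact: qlow.
Qed.

Lemma minimizer_exists v : admissible M v -> coercive (Gf v) ->
  exists S, minimizer (Gf v) S.
Proof.
move=> Av cG; have X0 : X 0 by exact: states0.
have [B HB] := cG (Gf v 0).
have B0 : B <= 0 by apply: HB.
have [] := @lsc_min R X (closed_states (k:=kind M)) (Gf v) B _ (Gf_lsc alpha01 Av).
- by exists 0.
- move=> r; exists (r / c) => y Xy _ Gr.
  rewrite ler_pdivlMr ?unit_cost_gt0// mulrC (le_trans _ Gr)// Gf_ge//.
move=> S [XS BS] minS; exists S; split => // y Xy.
have [By|yB] := leP B y; first exact: minS.
have Gy : Gf v 0 < Gf v y.
  by rewrite ltNge; apply/negP => /(HB y Xy); rewrite leNgt yB.
by rewrite (le_trans _ (ltW Gy))// minS.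
Qed.

End KConvexity.

(** * The slope of the holding cost at minus infinity *)

Lemma real_between (R : realType) (a : R) (x : \bar R) : (a%:E < x)%E ->
  exists r, a < r /\ (r%:E < x)%E.
Proof.
case: x => [s| |] //; last by move=> _; exists (a + 1); rewrite ltry ltrDl.
by rewrite lte_fin => ltas; exists ((a + s) / 2); rewrite lte_fin; split; lra.
Qed.

Section LeftEnd.
Variables (R : realType) (k : space_kind).
Local Notation X := (@states R k).
Local Open Scope ereal_scope.

Lemma states_below (B : R) : exists2 x, X x & (x < B)%R.
Proof.
have [y Xy yB] := @states_above R k (1 - B)%R.
by exists (- y)%R; [exact: statesN|lra].
Qed.

Lemma near_states_ninfty (Q : R -> Prop) (B : R) :
  (forall x, X x -> (x < B)%R -> Q x) -> \forall x \near @states_ninfty R k, Q x.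
Proof.
move=> H; rewrite /states_ninfty near_withinE; exists B; split; first exact: num_real.
by move=> x /= xB Xx; exact: H.
Qed.

Global Instance states_ninfty_proper : ProperFilter (@states_ninfty R k).
Proof.
apply: Build_ProperFilter_ex.
move=> Q [B [_ hB]]; have [x Xx xB] := states_below B.
by exists x; exact: (hB x xB).
Qed.

(** A function that is monotone near minus infinity converges there to its
  infimum. This makes sense of the limits in the definitions of k_h and of
  f_t(-oo), which are taken without asserting that they exist. *)
Lemma lim_ninfty_mono (f : R -> \bar R) (a : R) :
  (forall x y, X x -> X y -> (x <= y)%R -> (y < a)%R -> f x <= f y) ->
  lim (f x @[x --> @states_ninfty R k]) =
  ereal_inf [set f x | x in [set x | X x /\ (x < a)%R]].
Proof.
move=> fm; set l := ereal_inf _; apply: cvg_lim => //.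
have lf x : X x -> (x < a)%R -> l <= f x.
  by move=> Xx xa; apply: ereal_inf_lbound; exists x.
have fl b : l < b -> \forall x \near @states_ninfty R k, f x < b.
  move=> /ereal_inf_lt[_ [x0 [Xx0 x0a] <-] fb].
  apply: (@near_states_ninfty _ x0) => x Xx xx0.
  by apply: le_lt_trans fb; apply: fm => //; exact: ltW.
have nearl : \forall x \near @states_ninfty R k, l <= f x.
  exact: (@near_states_ninfty _ a).
case El : l => [r| |].
- apply/fine_cvgP; split.
    have : l < (r + 1)%:E by rewrite El lte_fin ltrDl.
    move=> /fl; apply: filterS2 nearl => x lx fx.
    rewrite fin_real//; apply/andP; split.
      by apply: lt_le_trans lx; rewrite El ltNyr.
    by apply: lt_trans fx _; rewrite ltry.
  apply/cvgrPdist_lt => e e0.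
  have : l < (r + e)%:E by rewrite El lte_fin ltrDl.
  move=> /fl; apply: filterS2 nearl => x lx fx.
  move: lx fx; rewrite El /=; case: (f x) => [s| |]//.
  rewrite lee_fin lte_fin /= => rs sr.
  by rewrite ler0_norm ?subr_le0//; lra.
- apply: (cvg_trans (near_eq_cvg _) (cvg_cst +oo)).
  apply: filterS nearl => x; rewrite El leye_eq => /eqP ->; reflexivity.
- apply/cvgeNyPle => b; have : l < b%:E by rewrite El ltNyr.
  by move=> /fl; apply: filterS => x /ltW.
Qed.

End LeftEnd.

Section HoldingSlope.
Context d (T : measurableType d) (R : realType) (P : probability T R).
Variable M : inventory P.
Local Notation X := (@states R (kind M)).
Local Notation h := (holding M).

Let slopes := [set (h x / x)%:E | x in [set x | X x /\ x < 0]].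

(** By convexity and h 0 = 0 the ratio h x / x is nondecreasing on the
  negative states. *)
Lemma k_hE : k_h M = (- ereal_inf slopes)%E.
Proof.
rewrite /k_h (@lim_ninfty_mono R (kind M) _ 0)// => x y Xx Xy xy y0.
have := holding_scaleN Xx Xy (ltW y0) xy => H.
have xy0 : 0 < x * y by nra.
rewrite lee_fin -(ler_pM2l xy0).
have -> : x * y * (h x / x) = y * h x by field; lra.
have -> : x * y * (h y / y) = x * h y by field; lra.
lra.
Qed.

Lemma k_h_gt (r : R) : (r%:E < k_h M)%E ->
  exists x0, [/\ X x0, x0 < 0 & r * (- x0) < h x0].
Proof.
rewrite k_hE lteNr -EFinN => /ereal_inf_lt[_ [x0 [Xx x0n] <-]].
rewrite lte_fin => H; exists x0; split => //.
have := H; rewrite ltr_ndivrMr//; lra.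
Qed.

Lemma k_h_le (r : R) : (k_h M <= r%:E)%E ->
  forall x, X x -> x < 0 -> h x <= r * (- x).
Proof.
rewrite k_hE leeNl -EFinN => H x Xx xn.
have : ((- r)%:E <= (h x / x)%:E)%E.
  by apply: (le_trans H); apply: ereal_inf_lbound; exists x.
rewrite lee_fin ler_ndivlMr//; lra.
Qed.

Lemma k_h_ge0 : (0 <= k_h M)%E.
Proof.
rewrite k_hE oppe_ge0; have [x Xx xn] := @states_below R (kind M) 0.
apply: (@le_trans _ _ (h x / x)%:E); first by apply: ereal_inf_lbound; exists x.
by rewrite lee_fin mulr_ge0_le0 ?invr_le0 ?(ltW xn)//; exact: holding_ge0.
Qed.

(** Beyond a state where h exceeds the line of slope r it stays above that
  line, again by monotonicity of the ratio. *)
Lemma holding_lower (r : R) : 0 <= r -> (r%:E < k_h M)%E ->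
  exists2 C, 0 <= C & forall x, X x -> x <= 0 -> r * (- x) - C <= h x.
Proof.
move=> r0 /k_h_gt[x0 [Xx0 x0n hx0]]; exists (r * (- x0)).
  by rewrite mulr_ge0//; lra.
move=> x Xx xn; have hx := holding_ge0 Xx.
have [xx0|x0x] := leP x x0.
  have H := holding_scaleN Xx Xx0 (ltW x0n) xx0.
  have xN : 0 <= - x by lra.
  have H' := ler_wpM2l xN (ltW hx0).
  have : - x0 * (r * - x) <= - x0 * h x by move: H H'; lra.
  rewrite ler_pM2l; last lra.
  have : 0 <= r * - x0 by rewrite mulr_ge0//; lra.
  lra.
have : 0 <= r * (x - x0) by rewrite mulr_ge0// subr_ge0 ltW.
lra.
Qed.

(** The slopes of the chords of a convex function with right end y decrease as
  the left end moves to minus infinity, to a limit that is at least - r. *)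
Lemma holding_lipschitz (r : R) : (k_h M <= r%:E)%E ->
  forall y' y, X y' -> X y -> y' <= y -> h y' <= h y + r * (y - y').
Proof.
move=> kr y' y Xy' Xy yy'; rewrite leNgt; apply/negP => H.
have r0 : 0 <= r by rewrite -lee_fin (le_trans _ kr)// k_h_ge0.
have hy := holding_ge0 Xy.
have yy : 0 < y - y'.
  rewrite subr_gt0 lt_neqAle yy' andbT; apply/eqP => E.
  by move: H; rewrite E subrr mulr0 addr0 ltxx.
pose e := h y' - h y - r * (y - y').
have e0 : 0 < e by rewrite /e; lra.
(* z is so far to the left that the excess e, multiplied by the length y - z,
   outweighs the bounded terms of the chord inequality *)
have := @states_below R (kind M) (Num.min (Num.min y' (-1))
   (- ((`|y| + `|y|) * (e + r * (y - y')) + 1) / e)).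
move=> [z Xz]; rewrite !lt_min => /andP[/andP[zy' z1] ze].
have z0 : z < 0 by lra.
have hz := k_h_le kr Xz z0.
have ch := holding_chord Xz Xy' Xy (ltW zy') yy'.
have ny : y <= `|y| by exact: ler_norm.
have ny' : - y <= `|y| by rewrite -normrN; exact: ler_norm.
move: ze; rewrite ltr_pdivlMr// => ze.
have h1 : h y' = h y + e + r * (y - y') by rewrite /e; ring.
rewrite h1 in ch.
have q1 : 0 <= r * (y - y') by rewrite mulr_ge0// ltW.
have q2 : (y - y') * h z <= (y - y') * (r * - z) by rewrite ler_wpM2l// ltW.
have q3 : 0 <= (`|y| + y) * (e + r * (y - y')).
  by rewrite mulr_ge0//; lra.
have q4 : 0 <= `|y| * (e + r * (y - y')) by rewrite mulr_ge0//; lra.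
have q5 : 0 <= (y - y') * h y by rewrite mulr_ge0// ltW.
clear kr; lra.
Qed.

End HoldingSlope.

(** * Behaviour of the cost functions at minus infinity *)

Section Coercivity.
Context d (T : measurableType d) (R : realType) (P : probability T R).
Variable M : inventory P.
Variable alpha : R.
Hypothesis alpha01 : 0 <= alpha < 1.
Local Notation X := (@states R (kind M)).
Local Notation h := (holding M).
Local Notation K := (setup_cost M).
Local Notation c := (unit_cost M).
Local Notation EXnext := (EXnext M).
Local Notation viter := (viter M alpha).
Local Notation Gf := (Gf M alpha).
Local Notation Gmin := (Gmin M alpha).
Local Notation bellman := (bellman M alpha).
Local Notation S := (total_demand M).

Let alpha0 : 0 <= alpha. Proof. by case/andP: alpha01. Qed.
Let alpha1 : 0 < 1 - alpha. Proof. by rewrite subr_gt0; case/andP: alpha01. Qed.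
Let K0 : 0 < K. Proof. exact: setup_cost_gt0. Qed.
Let c0 : 0 < c. Proof. exact: unit_cost_gt0. Qed.

Definition discount_sum (t : nat) : R := \sum_(i < t) alpha ^+ i.

Lemma discount_sumS t : discount_sum t.+1 = 1 + alpha * discount_sum t.
Proof.
rewrite /discount_sum big_ord_recl expr0 mulr_sumr; congr (_ + _).
by apply: eq_bigr => i _; rewrite -exprS.
Qed.

Lemma discount_sumE t : (1 - alpha) * discount_sum t = 1 - alpha ^+ t.
Proof.
elim: t => [|t IH]; first by rewrite /discount_sum big_ord0 mulr0 expr0 subrr.
by rewrite discount_sumS mulrDr mulr1 mulrCA IH exprS; ring.
Qed.

Lemma discount_sum_ge0 t : 0 <= discount_sum t.
Proof. by apply: sumr_ge0 => i _; exact: exprn_ge0. Qed.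

Lemma discount_sumS_gt0 t : 0 < discount_sum t.+1.
Proof. by rewrite discount_sumS; have := mulr_ge0 alpha0 (discount_sum_ge0 t); lra. Qed.

Lemma discount_sum_le t t' : (t <= t')%N -> discount_sum t <= discount_sum t'.
Proof.
elim: t' => [|t' IH]; first by rewrite leqn0 => /eqP ->.
rewrite leq_eqVlt => /predU1P[->//|/IH /le_trans]; apply.
by rewrite /discount_sum big_ord_recr/= lerDl exprn_ge0.
Qed.

Definition lower_slope (v : R -> R) (b : R) :=
  exists2 C, 0 <= C & forall x, X x -> x <= 0 -> b * (- x) - C <= v x.

Lemma lower_slope_EXnext v b : admissible M v -> 0 <= b -> lower_slope v b ->
  lower_slope (EXnext v) b.
Proof.
move=> Av b0 [C C0 HC]; exists C => // x Xx x0.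
apply: EXnext_ge_cst => // y Xy y0; apply: le_trans (HC _ (statesB Xx Xy) _).
  by rewrite lerD2r ler_wpM2l//; lra.
lra.
Qed.

Lemma lower_slope_Gf v r b : 0 <= r -> 0 <= b -> admissible M v ->
  lower_slope h r -> lower_slope v b -> lower_slope (Gf v) (r + alpha * b - c).
Proof.
move=> r0 b0 Av hr vb.
have [C1 C10 H1] := lower_slope_EXnext (admissible_holding M) r0 hr.
have [C2 C20 H2] := lower_slope_EXnext Av b0 vb.
exists (C1 + alpha * C2); first by rewrite addr_ge0// mulr_ge0.
move=> x Xx x0; have h1 := H1 x Xx x0.
have h2 := ler_wpM2l alpha0 (H2 x Xx x0).
by rewrite /Gf; move: h2; rewrite mulrBr; lra.
Qed.

(** The slope b available after t steps is limited by the holding costs r (1 +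
  ... + alpha^(t-1)) and by the price c of ordering back to the region near
  0. The hypothesis c (1 - alpha) <= r says that the cap c reproduces
  itself. *)
Lemma lower_slope_viter r : c * (1 - alpha) <= r -> lower_slope h r ->
  forall t b, 0 <= b <= c -> b <= r * discount_sum t -> lower_slope (viter t) b.
Proof.
move=> cr hr; have r0 : 0 <= r by apply: le_trans cr; rewrite mulr_ge0// ltW.
elim=> [|t IH] b /andP[b0 bc].
  rewrite /discount_sum big_ord0 mulr0 => b0'; exists 0 => // x _ _.
  have -> : b = 0 by lra.
  by rewrite mul0r subr0.
move=> bg; pose b' := Num.min c (r * discount_sum t).
have b'0 : 0 <= b' by rewrite le_min (ltW c0) mulr_ge0// discount_sum_ge0.
have b'c : 0 <= b' <= c by rewrite b'0 ge_min lexx.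
have Au := viter_admissible M alpha01 t.
have [C C0 HC] : lower_slope (Gf (viter t)) (r + alpha * b' - c).
  apply: lower_slope_Gf => //; apply: IH => //.
  by rewrite /b' ge_min lexx orbT.
have br : b <= r + alpha * b'.
  rewrite /b'; case: (leP c (r * discount_sum t)) => _; first by lra.
  by move: bg; rewrite discount_sumS; lra.
have HG x : X x -> x <= 0 -> (b - c) * (- x) - C <= Gf (viter t) x.
  move=> Xx x0; apply: le_trans (HC x Xx x0); rewrite lerD2r ler_wpM2r//; lra.
exists C => // x Xx x0.
have Hm : (b - c) * (- x) - C <= Gmin (viter t) x.
  apply: Gmin_ge => y Xy xy; have [y0|y0] := leP y 0.
    apply: le_trans (HG y Xy y0); rewrite lerD2r.
    have : 0 <= (c - b) * (y - x) by rewrite mulr_ge0 ?subr_ge0.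
    lra.
  have cy := Gf_ge alpha01 Au Xy.
  have : 0 <= c * y by rewrite mulr_ge0 ?ltW.
  have : 0 <= (c - b) * (- x) by rewrite mulr_ge0 ?subr_ge0//; lra.
  lra.
have Hx := HG x Xx x0; have K_gt0 := K0.
rewrite /= -/(viter t) /bellman lerBrDr le_min; apply/andP; split; lra.
Qed.

(** A slope r strictly between c / (1 + ... + alpha^t) and k_h leaves a
  positive total slope r + alpha b - c for Gf (viter t). *)
Lemma coercive_Gviter t : ((c / discount_sum t.+1)%:E < k_h M)%E -> coercive M (Gf (viter t)).
Proof.
have g0 := discount_sumS_gt0 t.
move=> kh; have [r [cr rk]] : exists r : R, c / discount_sum t.+1 < r /\ (r%:E < k_h M)%E.
  exact: real_between.
have rg : c < r * discount_sum t.+1 by rewrite -ltr_pdivrMr.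
have cr' : c * (1 - alpha) < r.
  have : c * (1 - alpha) * discount_sum t.+1 < r * discount_sum t.+1.
    apply: le_lt_trans rg; rewrite -mulrA discount_sumE mulrBr mulr1 gerBl.
    by rewrite mulr_ge0 ?exprn_ge0// ltW.
  by rewrite ltr_pM2r.
have r0 : 0 <= r by apply: le_trans (ltW cr'); rewrite mulr_ge0// ltW.
have hr : lower_slope h r by exact: holding_lower.
pose b' := Num.min c (r * discount_sum t).
have b'0 : 0 <= b' by rewrite le_min (ltW c0) mulr_ge0// discount_sum_ge0.
have Au := viter_admissible M alpha01 t.
have [C C0 HC] : lower_slope (Gf (viter t)) (r + alpha * b' - c).
  apply: lower_slope_Gf => //; apply: (lower_slope_viter (ltW cr') hr).
    by rewrite b'0 ge_min lexx.
  by rewrite /b' ge_min lexx orbT.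
pose e := r + alpha * b' - c.
have e0 : 0 < e.
  rewrite /e /b'; case: (leP c (r * discount_sum t)) => _; first by lra.
  by move: rg; rewrite discount_sumS; lra.
move=> s; exists (- ((`|s| + C) / e)) => y Xy Gy.
have [y0|y0] := leP y 0; last first.
  apply: le_trans (ltW y0); rewrite oppr_le0 divr_ge0 ?(ltW e0)//.
  by rewrite addr_ge0.
have := HC y Xy y0; rewrite -/e => H.
rewrite lerNl ler_pdivlMr// mulrC.
have := ler_norm s; lra.
Qed.

Lemma discount_slope : (alpha_star M < alpha%:E)%E ->
  ((c * (1 - alpha))%:E < k_h M)%E.
Proof.
rewrite /alpha_star; have := k_h_ge0 M.
case: (k_h M) => [s| |]//; last by rewrite ltry.
move=> _; rewrite -EFinM -EFinB !lte_fin => H.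
have : 1 - alpha < s / c by lra.
by rewrite ltr_pdivlMr// mulrC.
Qed.

Lemma discount_slopeN : (alpha%:E <= alpha_star M)%E ->
  (k_h M <= (c * (1 - alpha))%:E)%E.
Proof.
rewrite /alpha_star; have := k_h_ge0 M.
case: (k_h M) => [s| |]//.
  move=> _; rewrite -EFinM -EFinB !lee_fin => H.
  have : s / c <= 1 - alpha by lra.
  by rewrite ler_pdivrMr// mulrC.
by move=> _; rewrite gt0_mulye ?lte_fin ?invr_gt0.
Qed.

(** The sums 1 + ... + alpha^t tend to 1 / (1 - alpha). *)
Lemma exists_slope : (alpha_star M < alpha%:E)%E ->
  exists t, ((c / discount_sum t.+1)%:E < k_h M)%E.
Proof.
move=> /discount_slope kh.
have [r [cr rk]] : exists r : R, c * (1 - alpha) < r /\ (r%:E < k_h M)%E.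
  exact: real_between.
have ca0 : 0 < c * (1 - alpha) by rewrite mulr_gt0.
have r0 : 0 < r by exact: lt_trans cr.
have q0 : 0 < 1 - c * (1 - alpha) / r.
  by rewrite subr_gt0 ltr_pdivrMr// mul1r.
have /cvgrPdist_lt/(_ _ q0) [t _ /(_ t.+1 (leqnSn t))/=] : alpha ^+ n @[n --> \oo] --> 0.
  by apply: cvg_expr; rewrite ger0_norm//; case/andP: alpha01.
rewrite sub0r normrN ger0_norm ?exprn_ge0// => H.
exists t; apply: lt_trans rk; rewrite lte_fin ltr_pdivrMr ?discount_sumS_gt0//.
have H' : c * (1 - alpha) < r * (1 - alpha ^+ t.+1).
  have : alpha ^+ t.+1 * r < (1 - c * (1 - alpha) / r) * r by rewrite ltr_pM2r.
  rewrite mulrBl mul1r mulfVK ?gt_eqF//; lra.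
by rewrite -(ltr_pM2r alpha1) -mulrA [discount_sum _ * _]mulrC discount_sumE.
Qed.

Lemma total_demand_ge0 n w : 0 <= S n w.
Proof. by apply: sumr_ge0 => j _; exact: demand_ge0. Qed.

Lemma states_total_demand n w : X (S n w).
Proof.
by rewrite /total_demand; apply: (big_ind X) => [|x y|j _];
  [exact: states0|exact: statesD|exact: demand_states].
Qed.

Lemma measurable_total_demand n : measurable_fun setT (S n).
Proof.
apply: (@measurable_sum _ T R setT _ _ (fun j : 'I_n => demand M j)) => j.
exact: measurable_funP.
Qed.

Lemma measurable_holding_total n x : X x ->
  measurable_fun setT (fun w => h (x - S n w)).
Proof.
move=> Xx; apply: (measurable_comp (measurable_states (kind M)) (f := h)
  (g := fun w => x - S n w)).
- by move=> _ [w _ <-]; apply: statesB => //; exact: states_total_demand.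
- apply: lsc_measurable; first exact: closed_states.
  exact: holding_lsc.
- by apply: measurable_funB => //; exact: measurable_total_demand.
Qed.

Lemma integrable_demand_all j : P.-integrable setT (EFin \o demand M j).
Proof.
apply/integrableP; split; first by apply/measurable_EFinP; exact: measurable_funP.
have mabs : measurable_fun setT (fun y : R => (`|y|)%:E) by exact/measurable_EFinP.
have id : (\int[P]_w `|(EFin \o demand M j) w| = \int[P]_w `|(EFin \o demand M 0%N) w|)%E.
  have E i : (\int[P]_w `|(EFin \o demand M i) w| =
      \int[distribution P (demand M i)]_y (`|y|)%:E)%E.
    by rewrite ge0_integral_distribution// => y; rewrite lee_fin.
  rewrite !E; apply: eq_measure_integral => B mB _.
  exact: (@demand_ident _ _ _ _ M j B mB).
by rewrite id; have /integrableP[] := integrable_demand M.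
Qed.

Lemma integrable_total_demand n : P.-integrable setT (EFin \o S n).
Proof.
elim: n => [|n IH].
  rewrite (_ : _ \o _ = cst 0%E); first exact: integrable0.
  by apply/funext => w /=; rewrite /total_demand big_ord0.
have := integrableD measurableT IH (integrable_demand_all n).
apply: eq_integrable => // w _ /=.
by rewrite /total_demand big_ord_recr.
Qed.

(** With finite k_h the holding cost grows linearly at minus infinity, and the
  total demand is integrable. *)
Lemma integrable_holding_total (r : R) : (k_h M <= r%:E)%E -> forall n x, X x ->
  P.-integrable setT (EFin \o (fun w => h (x - S n w))).
Proof.
move=> kr n x Xx.
have r0 : 0 <= r by rewrite -lee_fin (le_trans _ kr)// k_h_ge0.
have iS : P.-integrable setT (EFin \o (fun w => h x + r * S n w)).
  have i1 : P.-integrable setT (EFin \o (fun w => r * S n w)).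
    have := integrableZl measurableT r (integrable_total_demand n).
    by apply: eq_integrable => // w _ /=; rewrite EFinM.
  have i2 : P.-integrable setT (EFin \o (fun _ : T => h x)).
    exact: finite_measure_integrable_cst.
  exact: (integrableD measurableT i2 i1).
apply: (le_integrable measurableT _ _ iS).
  by apply/measurable_EFinP; exact: measurable_holding_total.
move=> w _ /=; rewrite lee_fin.
have XS := statesB Xx (states_total_demand n w).
have S0 := total_demand_ge0 n w.
rewrite ger0_norm ?holding_ge0// (le_trans _ (ler_norm _))//.
have := holding_lipschitz kr XS Xx; rewrite gerBl => /(_ S0).
by rewrite opprB addrCA subrr addr0.
Qed.

(** If k_h (1 + ... + alpha^t) <= c, then f_t is finite and nondecreasing,
  because the slopes of its terms add up to at least 0; its limit at minus
  infinity is then its infimum. *)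
Lemma f_ninfty_neq (t : nat) : (k_h M <= (c / discount_sum t.+1)%:E)%E ->
  f_ninfty M alpha t <> +oo%E.
Proof.
move=> kr; set r := c / discount_sum t.+1 in kr.
have iS := integrable_holding_total kr.
pose e i x := \int[P]_w h (x - S i w).
have fE x : X x -> f_ M alpha t x =
    (c * x + \sum_(i < t.+1) alpha ^+ i * e i.+1 x)%:E.
  move=> Xx; rewrite /f_ EFinD -sumEFin; congr (_ + _)%E; apply: eq_bigr => i _.
  rewrite EFinM unlock; congr (_ * _)%E.
  by rewrite /e /Rintegral fineK//; apply: integrable_fin_num => //; exact: iS.
have eL i x y : X x -> X y -> x <= y -> e i x <= e i y + r * (y - x).
  move=> Xx Xy xy.
  have ic : P.-integrable setT (EFin \o (fun _ : T => r * (y - x))).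
    exact: finite_measure_integrable_cst.
  have -> : r * (y - x) = \int[P]_(w in setT) (r * (y - x)).
    rewrite Rintegral_cst// -[LHS]mulr1; congr (_ * _).
    by rewrite -[RHS]/(fine (P setT)) probability_setT.
  rewrite -RintegralD//; last exact: iS.
  apply: le_Rintegral => //; first exact: iS.
    exact: (integrableD measurableT (iS _ _ Xy) ic).
  move=> w _; have XS := states_total_demand i w.
  have := holding_lipschitz kr (statesB Xx XS) (statesB Xy XS).
  rewrite lerD2r => /(_ xy) H; apply: (le_trans H); rewrite lerD2l.
  by have -> : y - S i w - (x - S i w) = y - x by ring.
rewrite /f_ninfty (@lim_ninfty_mono R (kind M) _ 0); last first.
  move=> x y Xx Xy xy _; rewrite !fE// lee_fin.
  have : \sum_(i < t.+1) alpha ^+ i * e i.+1 x <=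
      \sum_(i < t.+1) alpha ^+ i * e i.+1 y + r * (y - x) * discount_sum t.+1.
    rewrite /discount_sum mulr_sumr -big_split; apply: ler_sum => i _ /=.
    by rewrite mulrC [X in _ + X]mulrC -mulrDr mulrC ler_wpM2l ?exprn_ge0// eL.
  have -> : r * (y - x) * discount_sum t.+1 = c * (y - x).
    by rewrite mulrAC /r mulfVK// gt_eqF// discount_sumS_gt0.
  lra.
have [x Xx x0] := @states_below R (kind M) 0.
move=> E; have : (ereal_inf [set f_ M alpha t x | x in [set x | X x /\ (x < 0)%R]]
   <= f_ M alpha t x)%E by apply: ereal_inf_lbound; exists x.
by rewrite E fE// leye_eq.
Qed.

Lemma f_ninfty_slope (t : nat) : f_ninfty M alpha t = +oo%E ->
  ((c / discount_sum t.+1)%:E < k_h M)%E.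
Proof. by move=> f; rewrite ltNge; apply/negP => /f_ninfty_neq. Qed.

Lemma f_ninfty_eq (t : nat) : ((c / discount_sum t.+1)%:E < k_h M)%E ->
  f_ninfty M alpha t = +oo%E.
Proof.
have g0 := discount_sumS_gt0 t.
move=> kh; have [r [cr rk]] : exists r : R, c / discount_sum t.+1 < r /\ (r%:E < k_h M)%E.
  exact: real_between.
have r0 : 0 <= r by apply: le_trans (ltW cr); rewrite divr_ge0 ?ltW.
have [C C0 HC] := holding_lower r0 rk.
have rg : 0 < r * discount_sum t.+1 - c by rewrite subr_gt0 -ltr_pdivrMr.
apply: cvg_lim => //; apply/cvgeyPge => B.
pose b := Num.max 0 ((B + C * discount_sum t.+1) / (r * discount_sum t.+1 - c)).
apply: (@near_states_ninfty _ _ _ (- b)) => x Xx xb.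
have b0 : 0 <= b by rewrite /b le_max lexx.
have x0 : x <= 0 by lra.
apply: (@le_trans _ _ (c * x + \sum_(i < t.+1) alpha ^+ i * (r * (- x) - C))%:E).
  rewrite lee_fin -mulr_suml -/(discount_sum t.+1).
  have : (B + C * discount_sum t.+1) / (r * discount_sum t.+1 - c) <= - x.
    by apply: (@le_trans _ _ b); [rewrite /b le_max lexx orbT|lra].
  rewrite ler_pdivrMr//; lra.
rewrite /f_ EFinD leeD2l// -sumEFin; apply: lee_sum => i _.
rewrite EFinM lee_wpmul2l ?lee_fin ?exprn_ge0// unlock.
have h0 w : 0 <= h (x - S i.+1 w).
  by apply: holding_ge0; apply: statesB => //; exact: states_total_demand.
have [rx|rx] := leP (r * (- x) - C) 0.
  apply: (@le_trans _ _ 0%E); first by rewrite lee_fin.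
  by apply: integral_ge0 => w _; rewrite lee_fin.
have -> : (r * - x - C)%:E = (\int[P]_w cst (r * - x - C)%:E w)%E.
  rewrite integral_cst// -[LHS]mule1; congr (_ * _)%E.
  by rewrite -[RHS]/(P setT) probability_setT.
apply: ge0_le_integral => //.
- by move=> w _; rewrite lee_fin ltW.
- by apply/measurable_EFinP; exact: measurable_holding_total.
move=> w _; rewrite lee_fin.
have XS := states_total_demand i.+1 w; have S0 := total_demand_ge0 i.+1 w.
apply: le_trans (HC _ (statesB Xx XS) _); last lra.
by rewrite lerD2r ler_wpM2l//; lra.
Qed.

(** An infimum of natural numbers is one of them; beyond it the slope
  condition persists since the sums increase with t. *)
Lemma N_attained : (alpha_star M < alpha%:E)%E ->
  exists t0, N_ M alpha = t0%:R%:E /\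
    forall t, (t0 <= t)%N -> coercive M (Gf (viter t)).
Proof.
move=> /exists_slope[t1 ht1].
pose Q t := `[< f_ninfty M alpha t = +oo%E >].
have exQ : exists t, Q t by exists t1; apply/asboolP; exact: f_ninfty_eq.
have [t0 /asboolP Qt0 mint0] := ex_minnP exQ; exists t0; split.
  apply/eqP; rewrite eq_le; apply/andP; split.
    by apply: ereal_inf_lbound; exists t0.
  apply: le_ereal_inf_tmp => _ [t /= ft <-]; rewrite lee_fin ler_nat.
  by apply: mint0; apply/asboolP.
move=> t t0t; apply: coercive_Gviter.
apply: le_lt_trans (f_ninfty_slope Qt0); rewrite lee_fin.
by rewrite ler_pM2l// lef_pV2 ?posrE ?discount_sumS_gt0// discount_sum_le.
Qed.

End Coercivity.

(** * Optimal policies *)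

Section Final.
Context d (T : measurableType d) (R : realType) (P : probability T R).
Variable M : inventory P.
Variable alpha : R.
Hypothesis alpha01 : 0 <= alpha < 1.
Local Notation X := (@states R (kind M)).
Local Notation h := (holding M).
Local Notation K := (setup_cost M).
Local Notation c := (unit_cost M).
Local Notation EXnext := (EXnext M).
Local Notation viter := (viter M alpha).
Local Notation vlim := (vlim M alpha).
Local Notation Gf := (Gf M alpha).

Let alpha0 : 0 <= alpha. Proof. by case/andP: alpha01. Qed.
Let K0 : 0 < K. Proof. exact: setup_cost_gt0. Qed.
Let c0 : 0 < c. Proof. exact: unit_cost_gt0. Qed.
Let Au t : admissible M (viter t). Proof. exact: viter_admissible. Qed.
Let Al : admissible M vlim. Proof. exact: vlim_admissible. Qed.

Lemma argmin_onE (Ge : R -> \bar R) (G : R -> R) S :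
  (forall x, X x -> Ge x = (G x)%:E) -> argmin_on X Ge S <-> minimizer M G S.
Proof.
move=> GE; split => -[XS H]; split => // y Xy; have := H y Xy.
  by rewrite !GE// lee_fin.
by rewrite !GE// lee_fin.
Qed.

Lemma coercive_le (G G' : R -> R) : (forall x, X x -> G x <= G' x) ->
  coercive M G -> coercive M G'.
Proof.
move=> GG' cG r; have [B HB] := cG r; exists B => y Xy Gy.
by apply: HB => //; apply: le_trans Gy; exact: GG'.
Qed.

(** By induction, viter t decreases by at most c per unit: E h contributes
  slope - c (1 - alpha) and the discounted continuation - alpha c, so c x
  dominates and Gf (viter t) is nondecreasing, whence waiting is optimal and
  the same bound holds for the next iterate. *)
Lemma never_order_conserving : (alpha%:E <= alpha_star M)%E ->
  conserving M alpha (fun=> 0).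
Proof.
move=> /discount_slopeN kr.
have lipG v : admissible M v ->
    (forall x' x, X x' -> X x -> x' <= x -> v x' <= v x + c * (x - x')) ->
    forall x' x, X x' -> X x -> x' <= x ->
      EXnext h x' + alpha * EXnext v x' <= EXnext h x + alpha * EXnext v x + c * (x - x').
  move=> Av lip x' x Xx' Xx xx'.
  have Eh : EXnext h x' <= EXnext h x + c * (1 - alpha) * (x - x').
    apply: EXnext_le => //; try exact: admissible_holding.
    move=> y Xy _; have := holding_lipschitz kr (statesB Xx' Xy) (statesB Xx Xy).
    rewrite lerD2r => /(_ xx').
    by have -> : x - y - (x' - y) = x - x' by ring.
  have Ev : EXnext v x' <= EXnext v x + c * (x - x').
    apply: EXnext_le => // y Xy _; have := lip _ _ (statesB Xx' Xy) (statesB Xx Xy).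
    rewrite lerD2r => /(_ xx').
    by have -> : x - y - (x' - y) = x - x' by ring.
  have := ler_wpM2l alpha0 Ev; rewrite mulrDr; lra.
have lip t : forall x' x, X x' -> X x -> x' <= x -> viter t x' <= viter t x + c * (x - x').
  elim: t => [|t IH] x' x Xx' Xx xx'.
    by rewrite /= add0r mulr_ge0 ?subr_ge0// ltW.
  have H := lipG _ (Au t) IH.
  have Gm y : X y -> x <= y -> Gf (viter t) x <= Gf (viter t) y.
    by move=> Xy xy; have := H x y Xx Xy xy; rewrite /Gf; lra.
  rewrite /= -/(viter t) /bellman.
  have -> : Num.min (Gf (viter t) x) (K + Gmin M alpha (viter t) x) = Gf (viter t) x.
    by rewrite min_l// (le_trans (Gmin_ge Gm))// lerDr ltW.
  have : Num.min (Gf (viter t) x') (K + Gmin M alpha (viter t) x') <= Gf (viter t) x'.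
    by rewrite ge_min lexx.
  have := H x' x Xx' Xx xx'; rewrite /Gf; lra.
have Gm x y : X x -> X y -> x <= y -> Gf vlim x <= Gf vlim y.
  move=> Xx Xy xy; apply: Gf_vlim_le => // t.
  apply: le_trans (Gf_viter_vlim alpha01 t Xy).
  by have := lipG _ (Au t) (lip t) x y Xx Xy xy; rewrite /Gf; lra.
split; first exact: measurable_cst.
move=> x Xx; split; first by apply/actionsE; split => //; exact: states0.
rewrite -[leRHS](vlim_fixed alpha01 Xx) /bellman min_l.
  by rewrite /step_cost ltxx addr0 /Gf; lra.
have H : Gf vlim x <= Gmin M alpha vlim x by apply: Gmin_ge => y Xy; exact: Gm.
by rewrite (le_trans H)// lerDr ltW.
Qed.

Section Coercive.
Variable t0 : nat.
Hypothesis cG : forall t, (t0 <= t)%N -> coercive M (Gf (viter t)).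

Lemma coercive_Gvlim : coercive M (Gf vlim).
Proof.
by apply: coercive_le (cG (leqnn t0)) => x; exact: Gf_viter_vlim.
Qed.

Lemma reorder_viterP t S : (t0 <= t)%N -> minimizer M (Gf (viter t)) S ->
  exists q, [/\ reorder_level M (G_fin M alpha t) S = q%:E, X q, q <= S,
    Gf (viter t) q <= K + Gf (viter t) S &
    forall y, X y -> y < q -> K + Gf (viter t) S < Gf (viter t) y].
Proof.
move=> t0t [XS _]; apply: reorder_levelP => //.
- by move=> x; exact: G_finE.
- exact: Gf_lsc.
- exact: cG.
Qed.

Lemma inf_sS_optimal S : minimizer M (Gf vlim) S ->
  let s := reorder_level M (G_inf M alpha) S in
  s \is a fin_num /\ sS_optimal M alpha (fine s) S.
Proof.
move=> mS; have XS := mS.1.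
have [q [-> Xq qS Gq qlow]] := @reorder_levelP _ _ _ _ M (G_inf M alpha) (Gf vlim) S
  (fun x Xx => G_infE alpha01 Xx) (Gf_lsc alpha01 Al) coercive_Gvlim XS.
split => //; split => //=; apply: conserving_optimal => //.
apply: sS_conserving => // [x Xx xq|x y Xx Xy qx xy]; first exact/ltW/qlow.
apply: (@wait_above _ _ _ _ M (Gf vlim) S q) => //.
exact: kconvex_Gvlim.
Qed.

Variable S : nat -> R.
Hypothesis mS : forall t, (t0 <= t)%N -> minimizer M (Gf (viter t)) (S t).
Let s t := reorder_level M (G_fin M alpha t) (S t).

(** From t0 on, all the functions lie above the one with index t0, which is
  coercive, and their minima lie below the value of the limit function at 0;
  so every S t and every reorder level lies in one bounded sublevel set. *)
Lemma sS_bounded : exists B : R, forall t, (t0 <= t)%N ->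
  (`|s t| <= B%:E)%E /\ `|S t| <= B.
Proof.
have X0 : X 0 by exact: states0.
pose r0 := Gf vlim 0.
have Sr t : (t0 <= t)%N -> Gf (viter t) (S t) <= r0.
  move=> t0t; have [_ H] := mS t0t; apply: le_trans (H 0 X0) _.
  exact: Gf_viter_vlim.
have Gt0 t y : (t0 <= t)%N -> X y -> Gf (viter t0) y <= Gf (viter t) y.
  by move=> t0t Xy; exact: Gf_viter_le.
have [B HB] := cG (leqnn t0) (K + r0).
have r0K : r0 <= K + r0 by rewrite lerDr ltW.
exists (`|B| + `|r0 / c|) => t t0t.
have [XS _] := mS t0t.
have Sle : S t <= r0 / c.
  rewrite ler_pdivlMr// mulrC; apply: le_trans (Sr t t0t).
  exact: Gf_ge.
have Sge : B <= S t.
  by apply: HB => //; apply: le_trans (Gt0 t _ t0t XS) _; rewrite (le_trans (Sr t t0t)).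
have [q [qE Xq qS Gq _]] := reorder_viterP t0t (mS t0t).
have qge : B <= q.
  apply: HB => //; apply: le_trans (Gt0 t _ t0t Xq) _.
  by rewrite (le_trans Gq)// lerD2l Sr.
have bd y : B <= y -> y <= r0 / c -> `|y| <= `|B| + `|r0 / c|.
  move=> By yr; rewrite ler_norml; apply/andP; split.
    have := ler_norm (- B); rewrite normrN; have := normr_ge0 (r0 / c); lra.
  have := ler_norm (r0 / c); have := normr_ge0 B; lra.
rewrite /s qE /= lee_fin; split; apply: bd => //.
exact: le_trans Sle.
Qed.

(** S* minimizes the limit function and its minimum is the limit of the
  minima, by Gf_cluster. A state to the left of s* is to the left of s t
  infinitely often, where ordering was strictly better; a state to the right
  of s* is to the right of s t infinitely often, where waiting was optimal;
  both inequalities pass to the limit. At s* itself the bound follows from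
  the bound at the levels s t. *)
Lemma sS_cluster sstar Sstar :
  cluster ((fun t : nat => (fine (s t), S t)) @ \oo) (sstar, Sstar) ->
  sS_optimal M alpha sstar Sstar.
Proof.
move=> cl.
(* a limit point, read off on indices beyond n and t0 *)
have near (e : R) n : 0 < e -> exists t, [/\ (n <= t)%N, (t0 <= t)%N,
    `|fine (s t) - sstar| < e & `|S t - Sstar| < e].
  move=> e0.
  have [] := cl ((fun t : nat => (fine (s t), S t)) @` [set t | (maxn n t0 <= t)%N])
    (ball sstar e `*` ball Sstar e).
  - by exists (maxn n t0) => // t /= ht; exists t.
  - by exists (ball sstar e, ball Sstar e) => //; split; exact: nbhsx_ballx.
  move=> _ [[t /= ht <-] [/= b1 b2]]; exists t; move: ht; rewrite geq_max => /andP[nt tt].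
  by split => //; rewrite distrC.
have sP t : (t0 <= t)%N -> [/\ X (fine (s t)), fine (s t) <= S t,
    Gf (viter t) (fine (s t)) <= K + Gf (viter t) (S t) &
    forall y, X y -> y < fine (s t) -> K + Gf (viter t) (S t) < Gf (viter t) y].
  by move=> tt; have [q [qE Xq qS Gq qlow]] := reorder_viterP tt (mS tt); rewrite /s qE.
have [Sm [XSm minSm]] := minimizer_exists alpha01 Al coercive_Gvlim.
have Sle t : (t0 <= t)%N -> Gf (viter t) (S t) <= Gf vlim Sm.
  move=> tt; have [_ H] := mS tt; apply: le_trans (H Sm XSm) _.
  exact: Gf_viter_vlim.
have [XS GS] : X Sstar /\ Gf vlim Sstar <= Gf vlim Sm.
  apply: (Gf_cluster alpha01 (y := S)) => e n e0.
  have [t [nt tt _ b]] := near e n e0; exists t => //; split => //; last exact: Sle.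
  by have [] := mS tt.
have minS : minimizer M (Gf vlim) Sstar.
  by split => // y Xy; apply: le_trans GS _; exact: minSm.
have sS : sstar <= Sstar.
  rewrite leNgt; apply/negP => Ss; pose e := (sstar - Sstar) / 2.
  have e0 : 0 < e by rewrite /e; lra.
  have [t [_ tt b1 b2]] := near e 0%N e0; have [_ st _ _] := sP t tt.
  move: b1 b2; rewrite !ltr_norml => /andP[b1 _] /andP[_ b2].
  by rewrite /e in b1 b2; lra.
split => //; apply: conserving_optimal => //; apply: sS_conserving => //.
  move=> x Xx xs; rewrite addrC -lerBrDr.
  suff [_ //] : X Sstar /\ Gf vlim Sstar <= Gf vlim x - K.
  apply: (Gf_cluster alpha01 (y := S)) => e n e0.
  have e1 : 0 < Num.min e (sstar - x) by rewrite lt_min e0 subr_gt0.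
  have [t [nt tt b1 b2]] := near _ n e1; exists t => //.
  have [XSt _] := mS tt; split => //.
    by move: b2; rewrite lt_min => /andP[].
  have [_ _ _ qlow] := sP t tt.
  have xst : x < fine (s t).
    by move: b1; rewrite lt_min ltr_norml [X in _ && X]ltr_norml => /andP[_ /andP[]]; lra.
  have := qlow x Xx xst; have := Gf_viter_vlim alpha01 t Xx; lra.
move=> x y Xx Xy; rewrite le_eqVlt => /predU1P[sx|sx] xy.
  suff [_ H] : X x /\ Gf vlim x <= K + Gf vlim Sm.
    by apply: le_trans H _; rewrite lerD2l; exact: minSm.
  apply: (Gf_cluster alpha01 (y := fine \o s)) => e n e0.
  have [t [nt tt b1 _]] := near _ n e0; exists t => //.
  have [Xs _ Gs _] := sP t tt; rewrite -sx; split => //=.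
  by apply: (le_trans Gs); rewrite lerD2l; exact: Sle.
apply: Gf_vlim_le => // m.
have e0 : 0 < x - sstar by rewrite subr_gt0.
have [t [mt tt b1 _]] := near _ m e0; have [Xs ss Gs _] := sP t tt.
have stx : fine (s t) <= x by move: b1; rewrite ltr_norml => /andP[_]; lra.
apply: (@le_trans _ _ (Gf (viter t) x)); first exact: Gf_viter_le.
apply: (@le_trans _ _ (K + Gf (viter t) y)).
  apply: (@wait_above _ _ _ _ M (Gf (viter t)) (S t) (fine (s t))) => //.
  - exact: kconvex_Gviter.
  - exact: mS.
by rewrite lerD2l; exact: Gf_viter_vlim.
Qed.

End Coercive.

End Final.

Theorem theorem4p4 (R : realType) (d : measure_display) (T : measurableType d)
    (P : probability T R) (M : inventory P) (alpha : R)
    (halpha : 0 <= alpha < 1) :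
  ((alpha_star M < alpha%:E)%E ->
    [/\ exists S, argmin_on (states (kind M)) (G_inf M alpha) S,
        forall S, argmin_on (states (kind M)) (G_inf M alpha) S ->
          let s := reorder_level M (G_inf M alpha) S in
          s \is a fin_num /\ sS_optimal M alpha (fine s) S,
        (N_ M alpha < +oo)%E /\
          forall t : nat, (N_ M alpha <= t%:R%:E)%E ->
            exists S, argmin_on (states (kind M)) (G_fin M alpha t) S
      & forall S : nat -> R,
          (forall t : nat, (N_ M alpha <= t%:R%:E)%E ->
             argmin_on (states (kind M)) (G_fin M alpha t) (S t)) ->
          let s := fun t : nat => reorder_level M (G_fin M alpha t) (S t) in
          (exists B : R, forall t : nat, (N_ M alpha <= t%:R%:E)%E ->
             (`|s t| <= B%:E)%E /\ `|S t| <= B) /\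
          forall sstar Sstar : R,
            cluster ((fun t : nat => (fine (s t), S t)) @ \oo) (sstar, Sstar) ->
            sS_optimal M alpha sstar Sstar])
  /\
  ((alpha%:E <= alpha_star M)%E -> never_order_optimal M alpha).
Proof.
split; last first.
  by move=> ha; apply: conserving_optimal => //; exact: never_order_conserving.
move=> /(N_attained halpha)[t0 [N0 cG]]; rewrite N0.
have amf t S := argmin_onE S (fun x Xx => @G_finE _ _ _ _ M alpha halpha t x Xx).
have ami S := argmin_onE S (fun x Xx => @G_infE _ _ _ _ M alpha halpha x Xx).
split.
- have [S mS] := minimizer_exists halpha (vlim_admissible M halpha) (coercive_Gvlim halpha cG).
  by exists S; apply/ami.
- by move=> S /ami mS; exact: (inf_sS_optimal halpha cG mS).
- split; first by rewrite ltry.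
  move=> t; rewrite lee_fin ler_nat => t0t.
  have [S mS] := minimizer_exists halpha (viter_admissible M halpha t) (cG t t0t).
  by exists S; apply/amf.
move=> S HS.
have mS t : (t0 <= t)%N -> minimizer M (Gf M alpha (viter M alpha t)) (S t).
  by move=> t0t; apply/amf; apply: HS; rewrite lee_fin ler_nat.
split.
  have [B HB] := sS_bounded halpha cG mS; exists B => t.
  by rewrite lee_fin ler_nat; exact: HB.
move=> sstar Sstar; exact: (sS_cluster halpha cG mS).
Qed.
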